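(* Suppose $H_1$ is true with a change point $m\in[\underline s,n-\underline s]$ and $|\delta_n|_\infty\le1$, and assume that (A) and (B) hold. Let $\alpha\in(0,1)$, $\zeta\in(0,1/2)$ and $\gamma\in(0,e^{-1})$ be such that $\log(\gamma^{-1})\le K\log(np)$ for some constant $K>0$. (i) If (C) holds and $$|\delta_n|_\infty\ge C_1\sqrt{\frac{\log(\zeta^{-1})\log(np)+\log(np/\alpha)}{n\,t_m(1-t_m)}}\qquad( * )$$ for some large enough constant $C_1:=C_1(\bar b,\underline b,K)>0$, then there exists a constant $C_2:=C_2(\bar b,\underline b,K)>0$ such that $$\mathbb P_1\big(T_n>q_{T_n^*\mid X_1^n}(1-\alpha)\big)\ge1-\gamma-C_2\varpi_{1,n}-2\zeta .$$ (ii) If (D) holds and $|\delta_n|_\infty$ obeys $( * )$ for some large enough constant $C_1:=C_1(\bar b,\underline b,K,q)>0$, then there exists a constant $C_2:=C_2(\bar b,\underline b,K,q)>0$ such that $$\mathbb P_1\big(T_n>q_{T_n^*\mid X_1^n}(1-\alpha)\big)\ge1-\gamma-C_2\{\varpi_{1,n}+\varpi_{2,n}\}-2\zeta .$$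
   Context: Let $n\ge 4$, $p\ge 3$. Mean-shift model: $X_i=\mu+\delta_n\mathbf 1(i>m)+\xi_i\in\mathbb R^p$, $i=1,\dots,n$, with $\mu,\delta_n\in\mathbb R^p$ and $\xi_1,\dots,\xi_n$ i.i.d. mean-zero random vectors in $\mathbb R^p$ with covariance matrix $\Sigma$. $H_1$: $\delta_n\ne0$ and there is a change point $m\in\{1,\dots,n-1\}$. Write $X_1^n=\{X_1,\dots,X_n\}$, $t_m=m/n$, and $\mathbb P_1$ for probability under $H_1$. CUSUM statistics: for $1\le s\le n-1$, $Z_n(s)=\sqrt{\frac{s(n-s)}{n}}\Big(\frac1s\sum_{i=1}^sX_i-\frac1{n-s}\sum_{i=s+1}^nX_i\Big)$. Let $\underline s\in[1,n/2]$ be a user-specified (integer) boundary removal parameter and $T_n=\max_{\underline s\le s\le n-\underline s}|Z_n(s)|_\infty$, where $|\cdot|_\infty$ is the maximum absolute coordinate. Bootstrap: let $e_1,\dots,e_n$ be i.i.d. $N(0,1)$ independent of $X_1^n$, $\bar X_s^-=s^{-1}\sum_{i=1}^sX_i$, $\bar X_s^+=(n-s)^{-1}\sum_{i=s+1}^nX_i$, $$Z_n^*(s)=\sqrt{\tfrac{n-s}{ns}}\sum_{i=1}^se_i(X_i-\bar X_s^-)-\sqrt{\tfrac{s}{n(n-s)}}\sum_{i=s+1}^ne_i(X_i-\bar X_s^+),$$ $T_n^*=\max_{\underline s\le s\le n-\underline s}|Z_n^*(s)|_\infty$, and $q_{T_n^*\mid X_1^n}(1-\alpha)=\inf\{t\in\mathbb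 R:\mathbb P(T_n^*\le t\mid X_1^n)\ge1-\alpha\}$. Conditions, for given constants $\underline b,\bar b,q>0$ and all $i=1,\dots,n$, $j=1,\dots,p$: (A) $\mathrm{Var}(\xi_{ij})\ge\underline b$. (B) $\mathbb E|\xi_{ij}|^{2+\ell}\le\bar b^\ell$ for $\ell=1,2$. (C) $\|\xi_{ij}\|_{\psi_1}\le\bar b$, where $\|X\|_{\psi_1}=\inf\{c>0:\mathbb E[\exp(|X|/c)-1]\le1\}$. (D) $\mathbb E[\max_{1\le j\le p}(|\xi_{ij}|/\bar b)^q]\le1$. Rates: $\varpi_{1,n}=\Big(\frac{\log^7(np)}{\underline s}\Big)^{1/6}$, $\varpi_{2,n}=\Big(\frac{n^{2/q}\log^3(np)}{\gamma^{2/q}\,\underline s}\Big)^{1/3}$. *)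

(* Defs.v *)
From HB Require Import structures.
From mathcomp Require Import all_boot all_order all_algebra.
From mathcomp Require Import all_classical all_reals all_analysis.

Set Implicit Arguments.
Unset Strict Implicit.
Unset Printing Implicit Defensive.

Import Order.TTheory GRing.Theory Num.Theory.
Import numFieldNormedType.Exports.

Local Open Scope classical_set_scope.
Local Open Scope ring_scope.

(** Random vectors in R^p are random variables with values in [p.-tuple R],
    which carries the product sigma-algebra; [vec] passes to row vectors, whose
    norm [`|v|] is the maximum of the absolute values of the entries.
    Observations are indexed by ['I_n], so that the informal index i in
    {1, ..., n} is [i.+1] and "informal i <= s" reads [(i < s)%N]. *)
Definition vec (R : realType) (p : nat) (x : p.-tuple R) : 'rV[R]_p :=
  \row_j tnth x j.

Section probability_notions.
Context d (Omega : measurableType d) (R : realType) (P : probability Omega R).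

Definition mutually_independent d' (T : measurableType d') (n : nat)
    (Y : 'I_n -> Omega -> T) : Prop :=
  forall B : 'I_n -> set T, (forall i, measurable (B i)) ->
    P (\bigcap_(i in [set: 'I_n]) (Y i @^-1` B i)) =
    (\prod_(i < n) fine (P (Y i @^-1` B i)))%:E.

Definition identically_distributed d' (T : measurableType d') (n : nat)
    (Y : 'I_n -> Omega -> T) : Prop :=
  forall (i k : 'I_n) (B : set T), measurable B ->
    P (Y i @^-1` B) = P (Y k @^-1` B).

Definition iid d' (T : measurableType d') (n : nat)
    (Y : 'I_n -> Omega -> T) : Prop :=
  mutually_independent Y /\ identically_distributed Y.

Definition independent_families d1 (T1 : measurableType d1)
    d2 (T2 : measurableType d2) (n1 n2 : nat)
    (Y : 'I_n1 -> Omega -> T1) (Z : 'I_n2 -> Omega -> T2) : Prop :=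
  forall A B : set Omega, g_sigma_preimage Y A -> g_sigma_preimage Z B ->
    P (A `&` B) = (P A * P B)%E.

Definition standard_normal (Y : Omega -> R) : Prop :=
  forall B : set R, measurable B -> P (Y @^-1` B) = normal_prob 0 1 B.

(** [k] is a regular version of the conditional law of [Y] given the
    sigma-algebra generated by the family [X]: being a kernel on the measurable
    space [(Omega, sigma(X))], [k ^~ B] is sigma(X)-measurable for every Borel
    set [B]. *)
Definition regular_conditional_law d' (T : measurableType d') (n : nat)
    (X : 'I_n -> Omega -> T) (Y : Omega -> R)
    (k : R.-pker (g_sigma_algebraType (g_sigma_preimage X)) ~> R) : Prop :=
  forall (A : set Omega) (B : set R), g_sigma_preimage X A -> measurable B ->
    (\int[P]_(w in A) k w B = P (A `&` Y @^-1` B))%E.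

(** The infimum is taken in the extended reals, since no [c] may qualify. *)
Definition psi1_norm (Y : Omega -> R) : \bar R :=
  ereal_inf [set c%:E | c in [set c : R | 0 < c /\
    ('E_P[fun w => (expR (`|Y w| / c) - 1)%R] <= 1)%E]].

End probability_notions.

Definition quantile (R : realType) (mu : set R -> \bar R) (a : R) : R :=
  inf [set t : R | (a%:E <= mu `]-oo, t]%classic)%E].

Section statistics.
Context (R : realType) (n p : nat).
Implicit Types (x : 'I_n -> 'rV[R]_p) (e : 'I_n -> R) (s : nat).

Definition mean_left x s : 'rV[R]_p :=
  s%:R^-1 *: \sum_(i < n | (i < s)%N) x i.

Definition mean_right x s : 'rV[R]_p :=
  (n - s)%N%:R^-1 *: \sum_(i < n | (s <= i)%N) x i.

Definition cusum x s : 'rV[R]_p :=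
  Num.sqrt (s%:R * (n - s)%N%:R / n%:R) *: (mean_left x s - mean_right x s).

Definition boot_cusum e x s : 'rV[R]_p :=
  Num.sqrt ((n - s)%N%:R / (n%:R * s%:R)) *:
    \sum_(i < n | (i < s)%N) e i *: (x i - mean_left x s) -
  Num.sqrt (s%:R / (n%:R * (n - s)%N%:R)) *:
    \sum_(i < n | (s <= i)%N) e i *: (x i - mean_right x s).

Definition test_stat (su : nat) x : R :=
  \big[Num.max/0]_(su <= s < (n - su).+1) `|cusum x s|.

Definition boot_stat (su : nat) e x : R :=
  \big[Num.max/0]_(su <= s < (n - su).+1) `|boot_cusum e x s|.

End statistics.

Definition mean_shift d (Omega : measurableType d) (R : realType) (n p : nat)
    (mu delta : 'rV[R]_p) (m : nat) (xi : 'I_n -> Omega -> p.-tuple R)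
    (i : 'I_n) (w : Omega) : p.-tuple R :=
  [tuple mu 0 j + (if (m <= i)%N then delta 0 j else 0) + tnth (xi i w) j
    | j < p].

Section setting.
Context d (Omega : measurableType d) (R : realType) (P : probability Omega R).
Context (n p : nat).

Definition noise_model (Sigma : 'M[R]_p)
    (xi : 'I_n -> {RV P >-> p.-tuple R}) : Prop :=
  [/\ iid P xi,
      forall i j, (fun w => tnth (xi i w) j) \in Lfun P 1,
      forall i j, ('E_P[fun w => tnth (xi i w) j] = 0)%E &
      forall i j k, covariance P (fun w => tnth (xi i w) j)
                                 (fun w => tnth (xi i w) k) = (Sigma j k)%:E].

Definition bootstrap_multipliers (X : 'I_n -> Omega -> p.-tuple R)
    (e : 'I_n -> {RV P >-> R}) : Prop :=
  [/\ mutually_independent P e,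
      forall i, standard_normal P (e i) &
      independent_families P e X].

Implicit Type xi : 'I_n -> Omega -> p.-tuple R.

Definition condA (blow : R) xi : Prop :=
  forall i j, (blow%:E <= 'V_P[fun w => tnth (xi i w) j])%E.

Definition condB (bup : R) xi : Prop :=
  forall i j (l : nat), (1 <= l <= 2)%N ->
    ('E_P[fun w => (`|tnth (xi i w) j| ^+ (2 + l))%R] <= (bup ^+ l)%:E)%E.

Definition condC (bup : R) xi : Prop :=
  forall i j, (psi1_norm P (fun w => tnth (xi i w) j) <= bup%:E)%E.

Definition condD (bup q : R) xi : Prop :=
  forall i, ('E_P[fun w =>
    (\big[Num.max/0]_(j < p) (`|tnth (xi i w) j| / bup) `^ q)%R] <= 1)%E.

End setting.

Section rates.
Context (R : realType) (n p su : nat).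

Definition log_np : R := ln (n * p)%N%:R.

Definition rate1 : R := (log_np ^+ 7 / su%:R) `^ 6^-1.

Definition rate2 (q gamma : R) : R :=
  (n%:R `^ (2 / q) * log_np ^+ 3 / (gamma `^ (2 / q) * su%:R)) `^ 3^-1.

Definition signal_threshold (m : nat) (alpha zeta : R) : R :=
  let t := m%:R / n%:R in
  Num.sqrt ((ln zeta^-1 * log_np + ln ((n * p)%N%:R / alpha)) /
            (n%:R * t * (1 - t))).

End rates.

(* Main.v *)
Require Import Defs.
From HB Require Import structures.
From mathcomp Require Import all_boot all_order all_algebra.
From mathcomp Require Import all_classical all_reals all_analysis.
From mathcomp Require Import measurable_realfun ring lra zify.

Set Implicit Arguments.
Unset Strict Implicit.
Unset Printing Implicit Defensive.

Import Order.TTheory GRing.Theory Num.Theory.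
Import numFieldNormedType.Exports.

Local Open Scope classical_set_scope.
Local Open Scope ring_scope.

(** The test compares [T] with a conditional Gaussian quantile, and it detects the
    change because three quantities can be controlled separately, by elementary
    exponential inequalities.  Write L for the logarithm of np, La for the
    logarithm of np / alpha (so that 1 <= L <= La), and v for a bound on the
    second moments of the noise coordinates.

    Signal.  At the true change point the CUSUM vector is, up to sign, the vector
    [delta] multiplied by the square root of m (n - m) / n, plus a linear form in
    the noise whose squared weights sum to 1.  Hence [T] is at least the size of
    the signal minus one noise term ([test_stat_signal]), and the signal
    condition makes the first part at least C1 times the square root of La.

    Noise.  Truncate the noise coordinates at a level M.  For a centred variable,
    one-sided truncation min(f, B) can only lower the mean, so its exponential
    moment is at most exp(2 l^2 v) as soon as l B <= 1/2, with no bias term to pay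
    for ([centered_truncated_mgf]).  The weights are at most the inverse square
    root of [su], so l = sqrt L is admissible when 6 M^2 L <= [su]; as long as the
    noise stays below M, each coordinate of the noise term is then at most
    (3 + 2 v) sqrt L outside an event of probability at most (np)^-3 for each
    sign.  The same truncation, now for nonnegative variables ([nonneg_truncated_mgf]), shows
    that every block average of squared noise is at most 2 v + 1 outside an event
    of the same order.  All the union bounds together cost 4 (np)^-2.

    Bootstrap quantile.  Given the data, each coordinate of the bootstrap CUSUM is
    a centred Gaussian variable.  Its variance is bounded by block averages of
    squares of the observations around any common centre, hence by 4 (1 + v) on
    the event just described, because [delta] has norm at most 1
    ([boot_variance_good]).  A union bound over the at most 2 np one-sided tails
    shows that the conditional quantile of order 1 - alpha is at most
    4 sqrt (1 + v) sqrt La ([bootstrap_quantile_good]).  To use only the defining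
    property of the conditional law, integrate over the data event on which this
    bound fails: independence of multipliers and data turns the joint integral
    into an iterated one, in which the data are frozen
    ([independent_integral_decouple]), and the event is then found to be null
    ([conditional_tail_negligible]).

    Choosing C1 larger than the sum of the two constants gives
    [bootstrap_test_power]: rejection has probability at least
    1 - eta - 4 (np)^-2 whenever the noise exceeds M with probability at most eta
    and 6 M^2 L <= [su].  Sub-exponential noise allows M of order L with
    eta = 2 (np)^-2, and the moment condition on the maximum allows
    M = bup (n / gamma)^(1/q) with eta = gamma.  Both (np)^-2 and, when
    6 M^2 L > [su], the constant 1 are absorbed by a multiple of the rates; in
    the second situation the claimed lower bound is not positive. *)

(** * Densities and independent variables *)

Section density.
Context d1 d2 (T1 : measurableType d1) (T2 : measurableType d2) (R : realType).
Variables (mu : {measure set T1 -> \bar R}) (nu : {measure set T2 -> \bar R}).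
Variables (Y : T1 -> T2) (g : T1 -> R).
Hypotheses (mY : measurable_fun setT Y) (mg : measurable_fun setT g)
  (g0 : forall x, 0 <= g x).
Hypothesis nuE : forall B, measurable B ->
  nu B = (\int[mu]_x (g x * \1_B (Y x))%:E)%E.

Import HBNNSimple.

Let density_nnsfun (h : {nnsfun T2 >-> R}) :
  (\int[nu]_y (h y)%:E = \int[mu]_x (g x * h (Y x))%:E)%E.
Proof.
have mh r : measurable (h @^-1` [set r]) by exact: measurable_sfunP.
have mhY r : measurable_fun setT (fun x => \1_(h @^-1` [set r]) (Y x) : R).
  by apply: measurableT_comp.
under eq_integral do rewrite fimfunE -fsumEFin//.
rewrite ge0_integral_fsum//; last 2 first.
  by move=> r; apply/measurable_EFinP; apply: measurable_funM.
  by move=> r y _; rewrite nnfun_muleindic_ge0.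
under [RHS]eq_integral => x _.
  rewrite fimfunE EFinM -fsumEFin// ge0_mule_fsumr; last first.
    by move=> r; rewrite nnfun_muleindic_ge0.
  over.
rewrite ge0_integral_fsum//; last 2 first.
  move=> r; apply: emeasurable_funM; first exact/measurable_EFinP.
  by apply/measurable_EFinP; apply: measurable_funM.
  by move=> r x _; rewrite mule_ge0 ?lee_fin// -lee_fin nnfun_muleindic_ge0.
apply: eq_fsbigr => r /[!inE] -[y _ <-].
under eq_integral do rewrite EFinM.
rewrite ge0_integralZl//; last 2 first.
- by apply/measurable_EFinP; exact: measurable_indic.
- by rewrite lee_fin.
rewrite integral_indic// setIT nuE// -ge0_integralZl//; last 3 first.
- by apply/measurable_EFinP; apply: measurable_funM.
- by move=> x _; rewrite lee_fin mulr_ge0.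
- by rewrite lee_fin.
by apply: eq_integral => x _; rewrite -!EFinM mulrCA.
Qed.

(** Knowing the image measure on sets only determines all integrals of nonnegative
    functions.  Used with [g] a normal density, and with [g] a product of other
    independent factors. *)
Lemma ge0_integral_density (f : T2 -> R) : measurable_fun setT f ->
  (forall y, 0 <= f y) ->
  (\int[nu]_y (f y)%:E = \int[mu]_x (g x * f (Y x))%:E)%E.
Proof.
move=> mf f0; have mf' : measurable_fun setT (EFin \o f) by exact/measurable_EFinP.
pose f_ := nnsfun_approx measurableT mf'.
have f0' y : setT y -> (0 <= (EFin \o f) y)%E by rewrite lee_fin.
transitivity (limn (fun n => \int[nu]_y (f_ n y)%:E)%E).
  rewrite -monotone_convergence//=.
  - apply: eq_integral => x _; apply/esym/cvg_lim => //=.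
    exact: (cvg_nnsfun_approx _ mf' f0').
  - by move=> n; exact/measurable_EFinP.
  - by move=> n x _; rewrite lee_fin.
  - by move=> x _ a b ab; rewrite lee_fin//; exact/lefP/nd_nnsfun_approx.
under eq_fun do rewrite density_nnsfun.
rewrite -monotone_convergence//=; first last.
- move=> x _ a b ab; rewrite lee_fin// ler_wpM2l//.
  exact/lefP/nd_nnsfun_approx.
- by move=> n x _; rewrite lee_fin mulr_ge0.
- by move=> n; apply/measurable_EFinP/measurable_funM => //; exact: measurableT_comp.
apply: eq_integral => x _; apply/cvg_lim => //=.
under eq_fun do rewrite EFinM.
rewrite EFinM; apply: cvgeZl => //.
exact: (cvg_nnsfun_approx _ mf' f0').
Qed.

End density.

(** Completing the square: exp(t x) times the standard density is exp(t^2 / 2)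
    times the density centred at t. *)
Lemma normal_mgf (R : realType) (nu : {measure set R -> \bar R}) (t : R) :
  (forall B, measurable B -> nu B = normal_prob 0 1 B) ->
  (\int[nu]_x (expR (t * x))%:E = (expR (t ^+ 2 / 2))%:E)%E.
Proof.
move=> nuE.
rewrite (@ge0_integral_density _ _ (measurableTypeR R) R R lebesgue_measure nu
  id (normal_pdf 0 1))//.
- transitivity (\int[lebesgue_measure]_x
     ((expR (t ^+ 2 / 2))%:E * (normal_pdf t 1 x)%:E)%E)%E; last first.
    rewrite ge0_integralZl ?integral_normal_pdf ?mule1//.
    + by apply/measurable_EFinP; exact: measurable_normal_pdf.
    + by move=> x _; rewrite lee_fin normal_pdf_ge0.
  apply: eq_integral => x _; rewrite -EFinM; congr EFin.
  rewrite !normal_pdfE ?oner_neq0//= /normal_fun mulrCA -!mulrA -!expRD.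
  by congr (_ * expR _); field.
- exact: measurable_normal_pdf.
- by move=> x; exact: normal_pdf_ge0.
- move=> B mB; rewrite nuE// /normal_prob [LHS]integral_mkcond; apply: eq_integral => x _.
  by rewrite patchE indicE; case: ifPn => xB /=; rewrite ?mulr1 ?mulr0.
- by apply: measurableT_comp => //; exact: measurable_funM.
Qed.

Section independent_product.
Context d (Omega : measurableType d) (R : realType) (P : probability Omega R).
Context d' (T : measurableType d') (n : nat) (Y : 'I_n -> {mfun Omega >-> T}).
Hypothesis indepY : mutually_independent P Y.

Let indicator_product (B : 'I_n -> set T) : (forall i, measurable (B i)) ->
  (\int[P]_w (\prod_(i < n) \1_(B i) (Y i w))%:E =
   (\prod_(i < n) fine (P (Y i @^-1` B i)))%:E)%E.
Proof.
move=> mB.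
rewrite -indepY//; set A := \bigcap_(i in _) _.
have mA : measurable A.
  rewrite /A bigcap_mkcond; apply: fin_bigcap_measurable => // i _.
  by case: ifPn => // _; rewrite -[X in measurable X]setTI; exact: measurable_funPT.
rewrite -[in RHS](setIT A) -integral_indic//; apply: eq_integral => w _.
congr EFin; rewrite indicE; have [wA|wA] := boolP (w \in A).
  rewrite big1// => i _; rewrite indicE mem_set//.
  by move: wA; rewrite inE; exact.
have [i Bi] : exists i, ~ B i (Y i w).
  apply/existsNP => AB; move: wA; rewrite notin_setE; apply => i _.
  exact: AB.
by rewrite (bigD1 i)//= indicE memNset// mul0r.
Qed.

(** The factors with index at least [k] are still indicators.  Raising [k] by one
    replaces a single indicator by a function, all other factors being frozen into
    a density. *)
Let product_partial (k : nat) (h : 'I_n -> T -> R) (a : 'I_n -> R) :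
  (forall i, measurable_fun setT (h i)) -> (forall i x, 0 <= h i x) ->
  (forall i, (\int[P]_w (h i (Y i w))%:E = (a i)%:E)%E) ->
  (forall i : 'I_n, (k <= i)%N -> exists2 B, measurable B & h i = \1_B) ->
  (\int[P]_w (\prod_(i < n) h i (Y i w))%:E = (\prod_(i < n) a i)%:E)%E.
Proof.
elim: k h a => [|k IH] h a mh h0 ah hB.
  have /choice[B hBE] i : exists B, measurable B /\ h i = \1_B.
    by have [B ? ?] := hB i (leq0n i); exists B.
  under eq_integral => w _ do under eq_bigr => i _ do rewrite (hBE i).2.
  rewrite indicator_product => [|i]; last by have [] := hBE i.
  congr EFin; apply: eq_bigr => i _; apply: EFin_inj; rewrite -ah.
  have [mB ->] := hBE i.
  rewrite fineK; last by rewrite fin_num_measure// -[X in measurable X]setTI;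
    exact: measurable_funPT.
  rewrite -[in LHS](setIT (Y i @^-1` B i)) -integral_indic//.
  by rewrite -[X in measurable X]setTI; exact: measurable_funPT.
have [kn|nk] := ltnP k n; last first.
  by apply: IH => // i ki; have := ltn_ord i; rewrite ltnNge (leq_trans nk).
pose i0 := Ordinal kn.
have a0 i : 0 <= a i.
  by rewrite -lee_fin -ah; apply: integral_ge0 => w _; rewrite lee_fin.
have c0 : 0 <= \prod_(i < n | i != i0) a i by apply: prodr_ge0.
under eq_integral => w _ do rewrite (bigD1 i0)//= mulrC.
rewrite (bigD1 i0)//= mulrC EFinM -ah.
have mhY i : measurable_fun setT (fun w => h i (Y i w)).
  by apply: measurableT_comp.
rewrite -(@ge0_integral_density _ _ _ _ _ P
  (mscale (NngNum c0) (pushforward P (Y i0))) (Y i0)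
  (fun w => \prod_(i < n | i != i0) h i (Y i w)))//=.
- rewrite ge0_integral_mscale//=; last 2 first.
    exact/measurable_EFinP.
    by move=> x _; rewrite lee_fin.
  rewrite ge0_integral_pushforward//=; first exact/measurable_EFinP.
  by move=> x _; rewrite lee_fin.
- by under eq_fun do rewrite -big_filter; exact: measurable_prod.
- by move=> w; apply: prodr_ge0.
move=> B mB.
have mYB : measurable (Y i0 @^-1` B).
  by rewrite -[X in measurable X]setTI; exact: measurable_funPT.
pose h' i := if i == i0 then \1_B else h i.
pose a' i := if i == i0 then fine (P (Y i0 @^-1` B)) else a i.
(* Checking the density hypothesis on a set [B] is the induction hypothesis with
   the factor i0 reset to the indicator of [B]. *)
transitivity (\prod_(i < n) a' i)%:E.
  rewrite [in RHS](bigD1 i0)//= {1}/a' eqxx mulrC EFinM fineK ?fin_num_measure//.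
  rewrite /mscale/= /pushforward; congr (_ * _)%E; congr EFin.
  by apply: eq_bigr => i /negbTE ii0; rewrite /a' ii0.
rewrite -(IH h')//.
- apply: eq_integral => w _; congr EFin.
  rewrite (bigD1 i0)//= {1}/h' eqxx mulrC; congr (_ * _).
  by apply: eq_bigr => i /negbTE ii0; rewrite /h' ii0.
- by move=> i; rewrite /h'; case: ifP.
- by move=> i x; rewrite /h'; case: ifP.
- move=> i; rewrite /h' /a'; case: ifPn => // /eqP ->.
  by rewrite fineK ?fin_num_measure// -[in RHS](setIT (Y i0 @^-1` B)) -integral_indic.
- move=> i ki; rewrite /h'; case: ifPn => [_|ii0]; first by exists B.
  by apply: hB; rewrite ltn_neqAle eq_sym ki andbT.
Qed.

(** Mutual independence is a product rule for sets; it passes to nonnegative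
    functions by exchanging one indicator at a time. *)
Lemma independent_integral_prod (h : 'I_n -> T -> R) (a : 'I_n -> R) :
  (forall i, measurable_fun setT (h i)) -> (forall i x, 0 <= h i x) ->
  (forall i, (\int[P]_w (h i (Y i w))%:E = (a i)%:E)%E) ->
  (\int[P]_w (\prod_(i < n) h i (Y i w))%:E = (\prod_(i < n) a i)%:E)%E.
Proof.
move=> mh h0 ah; apply: (@product_partial n) => // i.
by rewrite leqNgt ltn_ord.
Qed.

End independent_product.

(** * Exponential tail bounds *)

Lemma expR_mul1B_le1 (R : realType) (x : R) : x <= 1 -> expR x * (1 - x) <= 1.
Proof.
move=> x1; have := expR_ge1Dx (- x); rewrite expRN => h.
by rewrite -[leRHS](mulfV (lt0r_neq0 (expR_gt0 x))) ler_wpM2l// expR_ge0.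
Qed.

(** Since exp x <= 1 / (1 - x), a polynomial bound only needs a polynomial
    inequality after multiplication by 1 - x. *)
Lemma expR_le_quadratic (R : realType) (x : R) : x <= 1 / 2 ->
  expR x <= 1 + x + 2 * x ^+ 2.
Proof.
move=> x2; have x1 : x <= 1 by lra.
have x0 : 0 < 1 - x by lra.
rewrite -(ler_pM2r x0); apply: le_trans (expR_mul1B_le1 x1) _.
suff : 0 <= x ^+ 2 * (1 - 2 * x) by lra.
by rewrite mulr_ge0 ?sqr_ge0//; lra.
Qed.

Lemma expR_le_affine (R : realType) (x : R) : 0 <= x <= 1 / 2 ->
  expR x <= 1 + 2 * x.
Proof.
move=> /andP[x_ge0 x2]; have x1 : x <= 1 by lra.
have x0 : 0 < 1 - x by lra.
rewrite -(ler_pM2r x0); apply: le_trans (expR_mul1B_le1 x1) _.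
suff : 0 <= x * (1 - 2 * x) by lra.
by rewrite mulr_ge0//; lra.
Qed.

Section truncated.
Context d (Omega : measurableType d) (R : realType) (P : probability Omega R).

Lemma prob_le_integral (E : set Omega) (h : Omega -> R) : measurable E ->
  measurable_fun setT h -> (forall w, 0 <= h w) -> (forall w, E w -> 1 <= h w) ->
  (P E <= \int[P]_w (h w)%:E)%E.
Proof.
move=> mE mh h0 h1; rewrite -[E]setIT -integral_indic//.
apply: ge0_le_integral => //=.
- by apply/measurable_EFinP; exact: measurable_indic.
- exact/measurable_EFinP.
- move=> w _; rewrite lee_fin indicE.
  by have [/[!inE]/h1|_] := boolP (w \in E); last exact: h0.
Qed.

Lemma integral_probability_cst (r : R) : (\int[P]_w r%:E = r%:E)%E.
Proof. by rewrite integral_cst// [X in (_ * X)%E]probability_setT mule1. Qed.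

(** Truncating from above only: the linear term of the quadratic bound is at most
    l * f, which integrates to 0, and the square of the truncated variable is at
    most f ^+ 2.  A two-sided truncation would leave a bias of the first order. *)
Lemma centered_truncated_mgf (f : Omega -> R) (v l B : R) :
  P.-integrable setT (EFin \o f) -> (\int[P]_w (f w)%:E = 0)%E ->
  (\int[P]_w (f w ^+ 2)%:E <= v%:E)%E ->
  0 <= l -> 0 <= B -> l * B <= 1 / 2 ->
  (\int[P]_w (expR (l * Num.min (f w) B))%:E <= (expR (2 * l ^+ 2 * v))%:E)%E.
Proof.
move=> fi f0 f2 l0 B0 lB.
have mf : measurable_fun setT f by apply/measurable_EFinP; exact: measurable_int fi.
have mf2 : measurable_fun setT (fun w => f w ^+ 2) by exact: measurable_funX.
have f2i : P.-integrable setT (fun w => (f w ^+ 2)%:E).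
  apply/integrableP; split; first exact/measurable_EFinP.
  under eq_integral do rewrite /= ger0_norm ?sqr_ge0//.
  by apply: le_lt_trans f2 _; rewrite ltry.
have bnd w : expR (l * Num.min (f w) B) <= 1 + l * f w + 2 * l ^+ 2 * f w ^+ 2.
  have mB : Num.min (f w) B <= B by rewrite ge_min lexx orbT.
  have mf' : Num.min (f w) B <= f w by rewrite ge_min lexx.
  have sq : Num.min (f w) B ^+ 2 <= f w ^+ 2.
    rewrite /Num.min; case: ltP => // Bf.
    by rewrite lerXn2r// nnegrE (le_trans B0).
  apply: le_trans (expR_le_quadratic _) _.
    by apply: le_trans lB; rewrite ler_wpM2l.
  by rewrite lerD ?lerD ?ler_wpM2l// exprMn mulrA ler_wpM2l// mulr_ge0 ?sqr_ge0.
apply: (@le_trans _ _ (\int[P]_w ((1 + l * f w) + 2 * l ^+ 2 * f w ^+ 2)%:E)%E).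
  apply: ge0_le_integral => //=.
  - apply/measurable_EFinP; apply: measurableT_comp => //.
    by apply: measurable_funM => //; exact: measurable_minr.
  - by apply/measurable_EFinP; do ?[apply: measurable_funD|apply: measurable_funM].
  - by move=> w _; rewrite lee_fin.
have lfi : P.-integrable setT (fun w => (l * f w)%:E).
  under eq_fun do rewrite EFinM; exact: integrableZl.
under eq_integral do rewrite EFinD.
rewrite integralD//=; last 2 first.
- under eq_fun do rewrite EFinD; apply: integrableD => //.
  exact: finite_measure_integrable_cst.
- by under eq_fun do rewrite EFinM; exact: integrableZl.
under eq_integral do rewrite EFinD.
rewrite integralD//=; last exact: finite_measure_integrable_cst.
rewrite integral_probability_cst.
under [X in (_ + X + _)%E]eq_integral do rewrite EFinM.
rewrite integralZl//= f0 mule0 adde0.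
under [X in (_ + X)%E]eq_integral do rewrite EFinM.
rewrite integralZl//=; apply: (@le_trans _ _ (1 + (2 * l ^+ 2)%:E * v%:E)%E).
  by rewrite leeD2l// lee_wpmul2l// lee_fin mulr_ge0 ?sqr_ge0.
by rewrite -EFinM -EFinD lee_fin expR_ge1Dx.
Qed.

(** For nonnegative variables a first moment is enough, at the price of a bound of
    the first order in [l]. *)
Lemma nonneg_truncated_mgf (f : Omega -> R) (v l B : R) :
  measurable_fun setT f -> (forall w, 0 <= f w) ->
  (\int[P]_w (f w)%:E <= v%:E)%E -> 0 <= l -> 0 <= B -> l * B <= 1 / 2 ->
  (\int[P]_w (expR (l * Num.min (f w) B))%:E <= (expR (2 * l * v))%:E)%E.
Proof.
move=> mf f0 fv l0 B0 lB.
have bnd w : expR (l * Num.min (f w) B) <= 1 + 2 * l * f w.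
  apply: le_trans (expR_le_affine _) _.
    rewrite mulr_ge0 ?le_min ?f0//=.
    by apply: le_trans lB; rewrite ler_wpM2l// ge_min lexx orbT.
  by rewrite lerD2l -mulrA ler_wpM2l// ler_wpM2l// ge_min lexx.
apply: (@le_trans _ _ (\int[P]_w (1 + 2 * l * f w)%:E)%E).
  apply: ge0_le_integral => //=.
  - apply/measurable_EFinP; apply: measurableT_comp => //.
    by apply: measurable_funM => //; exact: measurable_minr.
  - by apply/measurable_EFinP; do ?[apply: measurable_funD|apply: measurable_funM].
  - by move=> w _; rewrite lee_fin.
under eq_integral do rewrite EFinD EFinM.
rewrite ge0_integralD//=; last 2 first.
- by move=> w _; rewrite mule_ge0 ?lee_fin// mulr_ge0.
- by apply: emeasurable_funM => //; exact/measurable_EFinP.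
rewrite integral_probability_cst ge0_integralZl//=; last 3 first.
- exact/measurable_EFinP.
- by move=> w _; rewrite lee_fin.
- by rewrite lee_fin mulr_ge0.
apply: (@le_trans _ _ (1 + (2 * l)%:E * v%:E)%E).
  by rewrite leeD2l// lee_wpmul2l// lee_fin mulr_ge0.
by rewrite -EFinM -EFinD lee_fin expR_ge1Dx.
Qed.

Context d' (T : measurableType d') (n : nat) (Y : 'I_n -> {mfun Omega >-> T}).
Hypothesis indepY : mutually_independent P Y.

Lemma independent_mgf_sum (g : 'I_n -> T -> R) (b : 'I_n -> R) :
  (forall i, measurable_fun setT (g i)) ->
  (forall i, (\int[P]_w (expR (g i (Y i w)))%:E <= (expR (b i))%:E)%E) ->
  (\int[P]_w (expR (\sum_(i < n) g i (Y i w)))%:E <= (expR (\sum_(i < n) b i))%:E)%E.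
Proof.
move=> mg gb; under eq_integral do rewrite expR_sum.
have ge0 i : (0 <= \int[P]_w (expR (g i (Y i w)))%:E)%E.
  by apply: integral_ge0 => w _; rewrite lee_fin expR_ge0.
have fin i : (\int[P]_w (expR (g i (Y i w)))%:E)%E \is a fin_num.
  by rewrite ge0_fin_numE//; apply: le_lt_trans (gb i) _; rewrite ltry.
rewrite (@independent_integral_prod _ _ _ _ _ _ _ Y indepY
  (fun i x => expR (g i x))
  (fun i => fine (\int[P]_w (expR (g i (Y i w)))%:E)%E)) => [|i|i x|i]; last 3 first.
- by apply: measurableT_comp.
- exact: expR_ge0.
- by rewrite fineK.
rewrite expR_sum lee_fin; apply: ler_prod => i _.
by rewrite fine_ge0//= -lee_fin fineK.
Qed.

(** The exponential parameter is absorbed into [g], so that different summands may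
    use different truncations. *)
Lemma chernoff_sum (g : 'I_n -> T -> R) (b : 'I_n -> R) (t : R) :
  (forall i, measurable_fun setT (g i)) ->
  (forall i, (\int[P]_w (expR (g i (Y i w)))%:E <= (expR (b i))%:E)%E) ->
  (P [set w | (t < \sum_(i < n) g i (Y i w))%R] <= (expR (\sum_(i < n) b i - t))%:E)%E.
Proof.
move=> mg gb.
have mS : measurable_fun setT (fun w => \sum_(i < n) g i (Y i w)).
  by apply: measurable_sum => i; exact: measurableT_comp.
apply: (@le_trans _ _ (\int[P]_w (expR (- t) * expR (\sum_(i < n) g i (Y i w)))%:E)%E).
  apply: prob_le_integral => //.
  - by rewrite -[X in measurable X]setTI; apply: (measurable_fun_ltr _ mS).
  - by apply: measurable_funM => //; exact: measurableT_comp.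
  - by move=> w /= tS; rewrite -expRD -[leLHS]expR0 ler_expR; lra.
under eq_integral do rewrite EFinM.
rewrite ge0_integralZl//; last first.
  by apply/measurable_EFinP; exact: measurableT_comp.
by rewrite addrC expRD EFinM lee_wpmul2l ?lee_fin ?expR_ge0// independent_mgf_sum.
Qed.

End truncated.

(** * Conditioning on the data *)

Section sigma_preimage.
Context d (Omega : measurableType d) d' (T : measurableType d') (n : nat).
Variable X : 'I_n -> Omega -> T.
Let FX : measurableType _ := g_sigma_algebraType (g_sigma_preimage X).

Lemma measurable_sigma_preimageE (A : set Omega) :
  measurable (A : set FX) = g_sigma_preimage X A.
Proof. by rewrite /measurable/= sigma_algebra_id//; exact: smallest_sigma_algebra. Qed.

Lemma sigma_preimage_measurable : (forall i, measurable_fun setT (X i)) ->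
  g_sigma_preimage X `<=` measurable.
Proof.
move=> mX; apply: smallest_sub; first exact: sigma_algebra_measurable.
move=> A; rewrite -bigcup_seq/= => -[i _ [B mB <-]].
exact: mX.
Qed.

Lemma measurable_fun_sigma_preimage i : measurable_fun setT (X i : FX -> T).
Proof.
move=> _ B mB; rewrite measurable_sigma_preimageE; apply: sub_sigma_algebra.
by rewrite -bigcup_seq/=; exists i; [exact: mem_index_enum|exists B].
Qed.

Lemma measurable_fun_coarsen d2 (T2 : measurableType d2) (f : Omega -> T2) :
  (forall i, measurable_fun setT (X i)) ->
  measurable_fun setT (f : FX -> T2) -> measurable_fun setT f.
Proof.
move=> mX mf _ B mB; apply: (sigma_preimage_measurable mX).
by rewrite -measurable_sigma_preimageE; exact: mf.
Qed.

End sigma_preimage.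

Section decoupling.
Context d (Omega : measurableType d) (R : realType) (P : probability Omega R).
Context d1 (T1 : measurableType d1) d2 (T2 : measurableType d2) (n1 n2 : nat).
Variables (Y : 'I_n1 -> Omega -> T1) (X : 'I_n2 -> Omega -> T2).
Hypotheses (mY : forall i, measurable_fun setT (Y i))
  (mX : forall i, measurable_fun setT (X i))
  (indep : independent_families P Y X).
Let FX : measurableType _ := g_sigma_algebraType (g_sigma_preimage X).
Let FY : measurableType _ := g_sigma_algebraType (g_sigma_preimage Y).

(** On rectangles, independence says that the diagonal map sends [P] to the product
    of its restrictions to the two sigma-algebras; a measure on a product is
    determined by rectangles, and the product integral can be iterated. *)
Lemma independent_integral_decouple (H : FX * FY -> R) :
  measurable_fun setT H -> (forall z, 0 <= H z) ->
  (\int[P]_w (H (w, w))%:E = \int[P]_w \int[P]_w' (H (w, w'))%:E)%E.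
Proof.
move=> mH H0.
have mid1 : measurable_fun setT (fun w : Omega => w : FX).
  by apply: (measurable_fun_coarsen mX); exact: measurable_id.
have mid2 : measurable_fun setT (fun w : Omega => w : FY).
  by apply: (measurable_fun_coarsen mY); exact: measurable_id.
have mdiag : measurable_fun setT (fun w : Omega => (w : FX, w : FY)).
  exact: measurable_fun_pair.
pose iX : {RV P >-> FX} := HB.pack (fun w : Omega => w : FX)
  (isMeasurableFun.Build _ _ _ _ _ mid1).
pose iY : {RV P >-> FY} := HB.pack (fun w : Omega => w : FY)
  (isMeasurableFun.Build _ _ _ _ _ mid2).
pose iXY : {RV P >-> (FX * FY)%type} := HB.pack (fun w : Omega => (w : FX, w : FY))
  (isMeasurableFun.Build _ _ _ _ _ mdiag).
have mH' : measurable_fun setT (EFin \o H) by exact/measurable_EFinP.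
have H0' z : (0 <= (EFin \o H) z)%E by rewrite lee_fin.
rewrite -(@ge0_integral_distribution _ _ _ _ _ P iXY _ mH' H0').
rewrite -(@eq_measure_integral _ _ _ _ (distribution P iXY)
  (distribution P iX \x distribution P iY)%E).
  rewrite fubini_tonelli1// /fubini_F ge0_integral_distribution//.
  - apply: eq_integral => w _ /=; rewrite ge0_integral_distribution//.
      by apply: (measurableT_comp mH'); exact: pair1_measurable.
    by move=> y; exact: (H0' (w, y)).
  - exact: (measurable_fun_fubini_tonelli_F _ mH' H0').
  - by move=> x; apply: integral_ge0 => y _; exact: (H0' (x, y)).
move=> A mA _; apply: product_measure_unique => // A1 A2 mA1 mA2.
rewrite /= /distribution /pushforward/= muleC -indep.
- by congr (P _); rewrite setIC.
- by rewrite -measurable_sigma_preimageE.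
- by rewrite -measurable_sigma_preimageE.
Qed.

End decoupling.

Section gaussian_multipliers.
Context d (Omega : measurableType d) (R : realType) (P : probability Omega R).
Context d2 (T2 : measurableType d2) (n n2 : nat).
Variables (e : 'I_n -> {RV P >-> R}) (X : 'I_n2 -> Omega -> T2).
Hypotheses (mX : forall i, measurable_fun setT (X i))
  (indepe : mutually_independent P e)
  (normale : forall i, standard_normal P (e i))
  (indep : independent_families P e X).
Let FX : measurableType _ := g_sigma_algebraType (g_sigma_preimage X).

Lemma standard_normal_mgf (t : R) i :
  (\int[P]_w (expR (t * e i w))%:E = (expR (t ^+ 2 / 2))%:E)%E.
Proof.
have me : measurable_fun setT (fun x : R => (expR (t * x))%:E).
  by apply/measurable_EFinP; apply: measurableT_comp => //; exact: measurable_funM.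
rewrite -(@ge0_integral_distribution _ _ _ _ _ P (e i) _ me); last first.
  by move=> x; rewrite lee_fin expR_ge0.
by apply: normal_mgf => B mB; exact: (normale i).
Qed.

Lemma gaussian_mgf_sum (a : 'I_n -> R) :
  (\int[P]_w (expR (\sum_(i < n) a i * e i w))%:E =
   (expR ((\sum_(i < n) a i ^+ 2) / 2))%:E)%E.
Proof.
under eq_integral do rewrite expR_sum.
rewrite (@independent_integral_prod _ _ _ _ _ _ _ e indepe
  (fun i x => expR (a i * x)) (fun i => expR (a i ^+ 2 / 2))) => [|i|i x|i].
- by rewrite -expR_sum mulr_suml.
- by apply: measurableT_comp => //; exact: measurable_funM.
- exact: expR_ge0.
- exact: standard_normal_mgf.
Qed.

(** After decoupling, the inner integral has constant coefficients, so that it is a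
    Gaussian exponential moment, bounded by the constraint on [A]. *)
Lemma conditional_gaussian_mgf (A : set Omega) (c : 'I_n -> Omega -> R) (s : R) :
  g_sigma_preimage X A ->
  (forall i, measurable_fun setT (c i : FX -> R)) ->
  (forall w, A w -> \sum_(i < n) c i w ^+ 2 <= s) ->
  (\int[P]_w (\1_A w * expR (\sum_(i < n) c i w * e i w))%:E <=
   (expR (s / 2))%:E * P A)%E.
Proof.
move=> FA mc cs.
have mA : measurable A by exact: (sigma_preimage_measurable mX).
have mA' : measurable (A : set FX) by rewrite measurable_sigma_preimageE.
have me i : measurable_fun setT (e i) by exact: measurable_funPT.
pose H (z : FX * g_sigma_algebraType (g_sigma_preimage (fun i => e i : Omega -> R))) :=
  \1_A z.1 * expR (\sum_(i < n) c i z.1 * e i z.2) : R.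
have mH : measurable_fun setT H.
  apply: measurable_funM.
    by apply: (measurableT_comp (f := \1_A : FX -> R)) => //; exact: measurable_indic.
  apply: measurableT_comp => //; apply: measurable_sum => i; apply: measurable_funM.
    exact: (measurableT_comp (mc i)).
  apply: measurableT_comp; last exact: measurable_snd.
  exact: (measurable_fun_sigma_preimage (X := fun i => e i : Omega -> R)).
rewrite (independent_integral_decouple me mX indep mH)/=; last first.
  by move=> z; rewrite mulr_ge0// expR_ge0.
under eq_integral => w _.
  rewrite /H/=; under eq_integral do rewrite EFinM.
  rewrite ge0_integralZl//; last first.
    apply/measurable_EFinP; apply: measurableT_comp => //.
    by apply: measurable_sum => i; exact: measurable_funM.
  rewrite gaussian_mgf_sum -EFinM; over.
rewrite -[X in P X]setIT -integral_indic// -ge0_integralZl//; last first.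
  by apply/measurable_EFinP; exact: measurable_indic.
apply: ge0_le_integral => //=.
- apply/measurable_EFinP; apply: measurable_funM => //.
  apply: measurableT_comp => //; apply: measurable_funM => //.
  apply: measurable_sum => i; apply: measurable_funX.
  by apply: (measurable_fun_coarsen mX); exact: mc.
- by apply: emeasurable_funM => //; apply/measurable_EFinP; exact: measurable_indic.
- move=> w _; rewrite -EFinM lee_fin mulrC indicE.
  have [/[!inE] wA|_] := boolP (w \in A); last by rewrite !mulr0.
  by rewrite !mulr1 ler_expR ler_pM2r// cs.
Qed.

End gaussian_multipliers.

(** * Quantiles of conditional laws *)

Section quantile.
Context (R : realType) (mu : probability R R).
Implicit Types (a t : R).

Let id_rv : {RV mu >-> R} := HB.pack (fun x : R => x)
  (isMeasurableFun.Build _ _ R R (fun x : R => x) (@measurable_id _ _ setT)).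

Let cdf_id t : cdf id_rv t = mu `]-oo, t]%classic.
Proof. by []. Qed.

Lemma quantile_set_has_lbound a : 0 < a ->
  has_lbound [set t : R | (a%:E <= mu `]-oo, t]%classic)%E].
Proof.
move=> a0; have /(_ (`]-oo, a%:E[%classic))  := @cvg_cdfNy0 _ _ _ mu id_rv.
case.
  by apply: open_nbhs_nbhs; split; [exact: lray_open|rewrite /= in_itv/= lte_fin].
move=> M [_ HM]; exists (M - 1) => t /= at_; rewrite leNgt; apply/negP => tM.
have /HM /= : t < M by lra.
by rewrite in_itv/= cdf_id ltNge at_.
Qed.

Lemma quantile_set_nonempty a : a < 1 ->
  [set t : R | (a%:E <= mu `]-oo, t]%classic)%E] !=set0.
Proof.
move=> a1; have /(_ (`]a%:E, +oo[%classic)) := @cvg_cdfy1 _ _ _ mu id_rv.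
case.
  by apply: open_nbhs_nbhs; split; [exact: rray_open|rewrite /= in_itv/= lte_fin a1].
move=> M [_ HM]; exists (M + 1) => /=.
have /HM /= : M < M + 1 by lra.
by rewrite in_itv/= cdf_id andbT => /ltW.
Qed.

Lemma quantile_le a t : 0 < a -> (a%:E <= mu `]-oo, t]%classic)%E ->
  quantile mu a <= t.
Proof. by move=> a0 at_; apply: ge_inf => //; exact: quantile_set_has_lbound. Qed.

(** Rational thresholds make the event measurable, being a countable union. *)
Lemma quantile_ltP a t : 0 < a < 1 -> quantile mu a < t <->
  exists r : rat, (a%:E <= mu `]-oo, (ratr r : R)]%classic)%E /\ ratr r < t.
Proof.
move=> /andP[a0 a1]; split; last first.
  by move=> [r [ar rt]]; apply: le_lt_trans rt; exact: quantile_le.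
move=> /(inf_lt (quantile_set_nonempty a1))[s /= as_ st].
have [r /itvP rst] := rat_in_itvoo st; exists r; rewrite rst; split => //.
apply: le_trans as_ _; apply: le_measure; rewrite ?inE//.
by move=> x /=; rewrite !in_itv/= => /le_trans; apply; rewrite rst.
Qed.

End quantile.

Section as_probability.
Context d (T : measurableType d) (R : realType) (mu : {measure set T -> \bar R}).

(** An alias of [mu], to which the structure of a probability can be attached. *)
Definition as_probability of mu [set: T] = 1%E : set T -> \bar R := mu.

Hypothesis mu1 : mu [set: T] = 1%E.

HB.instance Definition _ := isMeasure.Build _ _ _ (as_probability mu1)
  (measure0 mu) (measure_ge0 mu) (@measure_semi_sigma_additive _ _ _ mu).

HB.instance Definition _ :=
  Measure_isProbability.Build _ _ _ (as_probability mu1) mu1.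

End as_probability.

Section conditional_law.
Context d (Omega : measurableType d) (R : realType) (P : probability Omega R).
Context d' (T : measurableType d') (n : nat) (X : 'I_n -> Omega -> T).
Hypothesis mX : forall i, measurable_fun setT (X i).
Let FX : measurableType _ := g_sigma_algebraType (g_sigma_preimage X).
Variable k : R.-pker FX ~> R.

Let kernel_probability w : {mu : probability R R | (mu : set R -> \bar R) = k w}.
Proof.
by exists (as_probability (@prob_kernel _ _ _ _ _ k w)).
Qed.

Lemma measurable_fun_kernel B : measurable B -> measurable_fun setT (fun w : Omega => k w B).
Proof.
by move=> mB; apply: (measurable_fun_coarsen mX); exact: measurable_kernel.
Qed.

Lemma kernel_quantile_le a t w : 0 < a -> (a%:E <= k w `]-oo, t]%classic)%E ->
  quantile (k w) a <= t.
Proof. by have [mu <-] := kernel_probability w; exact: quantile_le. Qed.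

Lemma measurable_quantile_lt a (Y : Omega -> R) : 0 < a < 1 ->
  measurable_fun setT Y -> measurable [set w : Omega | quantile (k w) a < Y w].
Proof.
move=> a01 mY; rewrite (_ : [set w : Omega | _] = \bigcup_(r : rat)
  ([set w : Omega | (a%:E <= k w `]-oo, (ratr r : R)]%classic)%E] `&` [set w : Omega | ratr r < Y w])).
  apply: bigcupT_measurable_rat => r; apply: measurableI.
    rewrite -[X in measurable X]setTI.
    by apply: emeasurable_fun_c_infty => //; exact: measurable_fun_kernel.
  rewrite -[X in measurable X]setTI; apply: measurable_fun_ltr => //.
apply/seteqP; split => w /=; have [mu muE] := kernel_probability w.
  rewrite -muE => /(quantile_ltP _ _ a01)[r [ar rY]]; exists r => //=.
  by rewrite -muE.
rewrite -muE => -[r _ /= []]; rewrite -muE => ar rY.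
by apply/(quantile_ltP _ _ a01); exists r.
Qed.

(** On the exceptional event [A] the conditional law gives ]-oo, t] mass below
    1 - a, whereas its integral over [A] is P(A and Y <= t) >= (1 - a') P(A); with
    a' < a this forces P(A) = 0. *)
Lemma conditional_tail_negligible (Y : Omega -> R) (G : set Omega) (a a' t : R) :
  measurable_fun setT Y -> regular_conditional_law P Y k ->
  g_sigma_preimage X G -> a' < a ->
  (forall A, g_sigma_preimage X A -> A `<=` G ->
    P (A `&` [set w | (t < Y w)%R]) <= a'%:E * P A)%E ->
  let A := G `&` [set w : Omega | (k w `]-oo, t]%classic < (1 - a)%:E)%E] in
  g_sigma_preimage X A /\ P A = 0%E.
Proof.
move=> mY kY FG aa' tailY A.
have FA : g_sigma_preimage X A.
  rewrite -measurable_sigma_preimageE; apply: measurableI.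
    by rewrite measurable_sigma_preimageE.
  rewrite -[X in measurable X]setTI.
  by apply: emeasurable_fun_infty_o => //; exact: measurable_kernel.
split => //.
have mA : measurable A by exact: (sigma_preimage_measurable mX).
have mlt : measurable [set w | (t < Y w)%R].
  by rewrite -[X in measurable X]setTI; exact: measurable_fun_ltr.
have /= tA := tailY A FA (@subIsetl _ _ _).
have kA := kY A `]-oo, t]%classic FA (measurable_itv _).
have le1 : (\int[P]_(w in A) k w `]-oo, t]%classic <= (1 - a)%:E * P A)%E.
  rewrite -integral_cst//; apply: ge0_le_integral => //.
  - by apply: measurable_funTS; exact: measurable_fun_kernel.
  - by move=> w [_ /= /ltW].
have PAE : P A = (P (A `&` Y @^-1` `]-oo, t]%classic) + P (A `&` [set w | (t < Y w)%R]))%E.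
  rewrite -measureU//; first last.
  - rewrite -subset0 => w [[_ /=]]; rewrite in_itv/= => Yt [_ /=].
    by rewrite ltNge Yt.
  - exact: measurableI.
  - by apply: measurableI => //; rewrite -[X in measurable X]setTI; exact: mY.
  rewrite -setIUr; congr (P _); apply/esym/setIidPl => w _ /=.
  by rewrite in_itv/=; have [|] := leP (Y w) t; [left|right].
have : (P A <= (1 - a)%:E * P A + a'%:E * P A)%E.
  by rewrite {1}PAE; apply: leeD => //; rewrite -kA.
have /fineK <- : P A \is a fin_num by rewrite fin_num_measure.
rewrite -!EFinM -EFinD lee_fin => h.
have PA0 : 0 <= fine (P A) by rewrite fine_ge0.
congr EFin; apply/eqP; rewrite eq_le PA0 andbT.
have : (a - a') * fine (P A) <= 0 by lra.
by rewrite pmulr_rle0// subr_gt0.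
Qed.

End conditional_law.

Section gaussian_maximum.
Context d (Omega : measurableType d) (R : realType) (P : probability Omega R).
Context d2 (T2 : measurableType d2) (n n2 : nat).
Variables (e : 'I_n -> {RV P >-> R}) (X : 'I_n2 -> Omega -> T2).
Hypotheses (mX : forall i, measurable_fun setT (X i))
  (indepe : mutually_independent P e)
  (normale : forall i, standard_normal P (e i))
  (indep : independent_families P e X).
Let FX : measurableType _ := g_sigma_algebraType (g_sigma_preimage X).

(** Chernoff bound and union bound in one integral: the exponential moments of the
    2 #|J| signed forms are summed before integrating.  The parameter l = t / s
    minimises l ^+ 2 * s / 2 - l * t. *)
Lemma conditional_gaussian_max_tail (J : finType) (Q : pred J) (A E : set Omega)
    (c : J -> 'I_n -> Omega -> R) (s t : R) :
  0 < s -> 0 < t -> g_sigma_preimage X A ->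
  (forall j i, measurable_fun setT (c j i : FX -> R)) ->
  (forall w j, A w -> Q j -> \sum_(i < n) c j i w ^+ 2 <= s) ->
  measurable E ->
  (forall w, E w -> exists2 j, Q j & t < `|\sum_(i < n) c j i w * e i w|) ->
  (P (A `&` E) <= (2 * #|J|%:R * expR (- (t ^+ 2 / (2 * s))))%:E * P A)%E.
Proof.
move=> s0 t0 FA mc cs mE Et.
have mA : measurable A by exact: (sigma_preimage_measurable mX).
have [l lE] : {l | l = t / s} by exists (t / s).
have l0 : 0 < l by rewrite lE divr_gt0.
pose Z (b : bool) j w := \sum_(i < n) ((-1) ^+ b * l * c j i w) * e i w.
have ZE b j w : Z b j w = (-1) ^+ b * l * \sum_(i < n) c j i w * e i w.
  by rewrite /Z mulr_sumr; apply: eq_bigr => i _; rewrite -!mulrA.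
have mcO j i : measurable_fun setT (c j i : Omega -> R).
  by apply: (measurable_fun_coarsen mX); exact: mc.
have mZ b j : measurable_fun setT (Z b j).
  by apply: measurable_sum => i; apply: measurable_funM => //; exact: measurable_funM.
pose h (z : bool * J) w : R := if Q z.2 then \1_A w * expR (Z z.1 z.2 w) else 0.
have mh z : measurable_fun setT (h z).
  rewrite /h; case: (Q z.2) => //.
  by apply: measurable_funM; [exact: measurable_indic|exact: measurableT_comp].
have h0 z w : 0 <= h z w by rewrite /h; case: ifP => // _; rewrite mulr_ge0// expR_ge0.
apply: (@le_trans _ _ (\int[P]_w (expR (- (l * t)) * \sum_z h z w)%:E)%E).
  apply: prob_le_integral; first exact: measurableI.
  - by apply: measurable_funM => //; exact: measurable_sum.
  - by move=> w; rewrite mulr_ge0 ?expR_ge0// sumr_ge0.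
  - move=> w [Aw /Et[j Qj tj]].
    (* The sign of the large form selects the term of the sum that exceeds 1. *)
    pose b := \sum_(i < n) c j i w * e i w < 0.
    rewrite (bigD1 (b, j))//= mulrDr -[leLHS]addr0 lerD//; last first.
      by rewrite mulr_ge0 ?expR_ge0// sumr_ge0.
    rewrite /h/= Qj indicE mem_set// mul1r -expRD -[leLHS]expR0 ler_expR ZE.
    by rewrite -mulrA mulrCA /b -normrEsign addrC subr_ge0 ler_wpM2l// ltW.
have zle z : (\int[P]_w (h z w)%:E <= (expR (l ^+ 2 * s / 2))%:E * P A)%E.
  rewrite /h; have [Qz|_] := boolP (Q z.2); last by rewrite integral0 mule_ge0// lee_fin expR_ge0.
  apply: (conditional_gaussian_mgf mX indepe normale indep FA).
    by move=> i; apply: measurable_funM => //; exact: mc.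
  move=> w Aw; under eq_bigr do rewrite exprMn exprMn sqrr_sign mul1r.
  by rewrite -mulr_sumr ler_wpM2l ?sqr_ge0// cs.
under eq_integral => w _ do rewrite EFinM -sumEFin.
rewrite ge0_integralZl//; last 2 first.
- by apply: emeasurable_sum => z; exact/measurable_EFinP.
- by move=> w _; apply: sume_ge0 => z _; rewrite lee_fin.
rewrite ge0_integral_sum//; last 2 first.
- by move=> z; exact/measurable_EFinP.
- by move=> z w _; rewrite lee_fin.
apply: (@le_trans _ _ ((expR (- (l * t)))%:E *
    (\sum_(z : bool * J) (expR (l ^+ 2 * s / 2))%:E * P A))%E).
  by rewrite lee_wpmul2l ?lee_fin ?expR_ge0//; apply: lee_sum => z _; exact: zle.
have /fineK <- : P A \is a fin_num by rewrite fin_num_measure.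
under eq_bigr do rewrite -EFinM.
rewrite sumEFin -!EFinM lee_fin sumr_const card_prod card_bool.
rewrite -(mulr_natl _ (2 * #|J|)%N) natrM.
have -> : - (t ^+ 2 / (2 * s)) = - (l * t) + l ^+ 2 * s / 2.
  by rewrite lE; field; rewrite gt_eqF.
rewrite expRD le_eqVlt; apply/orP; left; apply/eqP; ring.
Qed.

End gaussian_maximum.

(** * CUSUM statistics as linear forms *)

Lemma measurable_bigmax d (Omega : measurableType d) (R : realType) (I : Type)
  (r : seq I) (F : I -> Omega -> R) : (forall i, measurable_fun setT (F i)) ->
  measurable_fun setT (fun w => \big[Num.max/0]_(i <- r) F i w).
Proof.
move=> mF; elim: r => [|i r IH].
  by under eq_fun do rewrite big_nil; exact: measurable_cst.
by under eq_fun do rewrite big_cons; exact: measurable_maxr.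
Qed.

Section rows.
Context (R : realType) (p : nat).

Lemma row_normE (v : 'rV[R]_p) : `|v| = \big[Num.max/0]_(j < p) `|v 0 j|.
Proof.
rewrite /Num.norm/= mx_normrE; apply/le_anti/andP; split.
  apply: bigmax_le => [|[i j] _ /=]; first exact: bigmax_ge_id.
  by rewrite (ord1 i); exact: (le_bigmax _ (fun j => `|v 0 j|)).
apply: bigmax_le => [|j _]; first exact: bigmax_ge_id.
exact: (le_bigmax _ (fun ij : 'I_1 * 'I_p => `|v ij.1 ij.2|) (0, j)).
Qed.

Lemma row_norm_coord (v : 'rV[R]_p) j : `|v 0 j| <= `|v|.
Proof. by rewrite row_normE; exact: (le_bigmax _ (fun j => `|v 0 j|)). Qed.

Lemma row_norm_gt (v : 'rV[R]_p) t : 0 <= t -> t < `|v| -> exists j, t < `|v 0 j|.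
Proof.
move=> t0; rewrite row_normE ltNge => /negP tv; apply: contrapT => /forallNP vt; apply: tv.
by apply: bigmax_le => // j _; rewrite leNgt; apply/negP/vt.
Qed.

Lemma row_norm_attained (v : 'rV[R]_p) : (0 < p)%N -> exists j, `|v 0 j| = `|v|.
Proof.
move=> p0; have [v0|v0] := eqVneq v 0.
  by exists (Ordinal p0); rewrite v0 mxE !normr0.
have [|[i j] /= vij] := @mx_norm_neq0 _ _ _ v.
  by apply: contra v0 => /eqP /mx_norm_eq0 ->.
by exists j; rewrite /Num.norm/= vij (ord1 i).
Qed.

Lemma measurable_row_norm d (Omega : measurableType d) (v : Omega -> 'rV[R]_p) :
  (forall j, measurable_fun setT (fun w => v w 0 j)) ->
  measurable_fun setT (fun w => `|v w|).
Proof.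
move=> mv; under eq_fun do rewrite row_normE.
by apply: measurable_bigmax => j; exact: measurableT_comp.
Qed.

End rows.

Section split_sums.
Context (R : realType) (n s : nat).
Hypothesis sn : (0 < s < n)%N.

Lemma sum_split_nat (F : 'I_n -> R) :
  \sum_(i < n) F i = \sum_(i < n | (i < s)%N) F i + \sum_(i < n | (s <= i)%N) F i.
Proof.
rewrite (bigID (fun i : 'I_n => (i < s)%N))/=; congr (_ + _).
by apply: eq_bigl => i; rewrite -leqNgt.
Qed.

Lemma sum_left_const (c : R) : \sum_(i < n | (i < s)%N) c = s%:R * c.
Proof.
have [_ /ltnW sn'] := andP sn.
by rewrite -(big_ord_widen _ (fun=> c) sn') sumr_const card_ord mulr_natl.
Qed.

Lemma sum_right_const (c : R) : \sum_(i < n | (s <= i)%N) c = (n - s)%N%:R * c.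
Proof.
have [_ /ltnW sn'] := andP sn.
have := sum_split_nat (fun=> c); rewrite sum_left_const sumr_const card_ord.
rewrite -[c *+ n]mulr_natl => h; apply: (@addrI _ (s%:R * c)).
by rewrite -h -mulrDl -natrD subnKC.
Qed.

(** The CUSUM and its bootstrap version are both linear forms with these
    coefficients, applied to the observations and to the multipliers times the
    residuals. *)
Definition cusum_weight (i : 'I_n) : R :=
  if (i < s)%N then Num.sqrt ((n - s)%N%:R / (n%:R * s%:R))
  else - Num.sqrt (s%:R / (n%:R * (n - s)%N%:R)).

Let s0 : 0 < s%:R :> R. Proof. by rewrite ltr0n; case/andP: sn. Qed.
Let ns0 : 0 < (n - s)%N%:R :> R. Proof. by rewrite ltr0n subn_gt0; case/andP: sn. Qed.
Let n0 : 0 < n%:R :> R.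
Proof. by rewrite ltr0n; case/andP: sn => _; exact: leq_ltn_trans. Qed.
Let nE : n%:R = s%:R + (n - s)%N%:R :> R.
Proof. by rewrite -natrD subnKC//; case/andP: sn => _ /ltnW. Qed.

Let sqrt_left : Num.sqrt (s%:R * (n - s)%N%:R / n%:R) * s%:R^-1 =
  Num.sqrt ((n - s)%N%:R / (n%:R * s%:R)) :> R.
Proof.
rewrite -[X in _ * X](gtr0_norm (x := s%:R^-1)) ?invr_gt0// -sqrtr_sqr -sqrtrM.
  by congr Num.sqrt; field; rewrite !gt_eqF.
by rewrite ltW// divr_gt0// mulr_gt0.
Qed.

Let sqrt_right : Num.sqrt (s%:R * (n - s)%N%:R / n%:R) * (n - s)%N%:R^-1 =
  Num.sqrt (s%:R / (n%:R * (n - s)%N%:R)) :> R.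
Proof.
rewrite -[X in _ * X](gtr0_norm (x := (n - s)%N%:R^-1)) ?invr_gt0// -sqrtr_sqr -sqrtrM.
  by congr Num.sqrt; field; rewrite !gt_eqF.
by rewrite ltW// divr_gt0// mulr_gt0.
Qed.

Lemma cusum_weight_sqr i : cusum_weight i ^+ 2 =
  if (i < s)%N then (n - s)%N%:R / (n%:R * s%:R) else s%:R / (n%:R * (n - s)%N%:R).
Proof.
by rewrite /cusum_weight; case: ifP => _; rewrite ?sqrrN sqr_sqrtr//
  ltW// divr_gt0// mulr_gt0.
Qed.

Lemma sum_cusum_weight_sqr : \sum_(i < n) cusum_weight i ^+ 2 = 1.
Proof.
rewrite sum_split_nat.
under eq_bigr => i si do rewrite cusum_weight_sqr si.
under [X in _ + X]eq_bigr => i si do rewrite cusum_weight_sqr ltnNge si/=.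
rewrite sum_left_const sum_right_const nE; field.
by rewrite -nE !gt_eqF.
Qed.

Lemma sum_cusum_weight_right :
  \sum_(i < n | (s <= i)%N) cusum_weight i = - Num.sqrt (s%:R * (n - s)%N%:R / n%:R).
Proof.
under eq_bigr => i si do rewrite /cusum_weight ltnNge si/= -sqrt_right.
by rewrite sum_right_const mulrN mulrCA divff ?mulr1// gt_eqF.
Qed.

Lemma sum_cusum_weight : \sum_(i < n) cusum_weight i = 0.
Proof.
rewrite sum_split_nat sum_cusum_weight_right.
under eq_bigr => i si do rewrite /cusum_weight si -sqrt_left.
by rewrite sum_left_const mulrCA divff ?mulr1 ?subrr// gt_eqF.
Qed.

Lemma cusum_weight_sqr_le (su : nat) i : (0 < su)%N -> (su <= s <= n - su)%N ->
  cusum_weight i ^+ 2 <= su%:R^-1.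
Proof.
move=> su0 /andP[sus snsu]; have su0R : 0 < su%:R :> R by rewrite ltr0n.
have [_ sn'] := andP sn.
have sunsR : su%:R <= (n - s)%N%:R :> R by rewrite ler_nat; lia.
have susR : su%:R <= s%:R :> R by rewrite ler_nat.
rewrite cusum_weight_sqr; case: ifP => _.
  apply: (@le_trans _ _ s%:R^-1); last by rewrite lef_pV2.
  rewrite ler_pdivrMr ?mulr_gt0// nE mulrCA mulVf ?gt_eqF// mulr1.
  by rewrite lerDr ltW.
apply: (@le_trans _ _ (n - s)%N%:R^-1); last by rewrite lef_pV2.
rewrite ler_pdivrMr ?mulr_gt0// nE mulrCA mulVf ?gt_eqF// mulr1.
by rewrite lerDl ltW.
Qed.

Lemma cusumE p (x : 'I_n -> 'rV[R]_p) j :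
  cusum x s 0 j = \sum_(i < n) cusum_weight i * x i 0 j.
Proof.
rewrite /cusum /mean_left /mean_right !mxE !summxE mulrDr mulrN !mulrA.
rewrite sqrt_left sqrt_right sum_split_nat !mulr_sumr -sumrN; congr (_ + _).
  by apply: eq_bigr => i si; rewrite /cusum_weight si.
by apply: eq_bigr => i si; rewrite /cusum_weight ltnNge si mulNr.
Qed.

Definition centered p (x : 'I_n -> 'rV[R]_p) (j : 'I_p) (i : 'I_n) : R :=
  x i 0 j - (if (i < s)%N then mean_left x s else mean_right x s) 0 j.

Lemma boot_cusumE p (e : 'I_n -> R) (x : 'I_n -> 'rV[R]_p) j :
  boot_cusum e x s 0 j = \sum_(i < n) (cusum_weight i * centered x j i) * e i.
Proof.
rewrite /boot_cusum !mxE !summxE sum_split_nat !mulr_sumr -sumrN; congr (_ + _).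
  by apply: eq_bigr => i si; rewrite /cusum_weight /centered si !mxE; ring.
by apply: eq_bigr => i si; rewrite /cusum_weight /centered ltnNge si !mxE /=; ring.
Qed.

(** Among all centres the mean minimises the sum of squares; the difference of the
    two sides is c (mean - a)^2. *)
Lemma sum_sqr_center_le (Q : pred 'I_n) (y : 'I_n -> R) (c a : R) :
  0 < c -> \sum_(i | Q i) (1 : R) = c ->
  \sum_(i | Q i) (y i - c^-1 * \sum_(i | Q i) y i) ^+ 2 <= \sum_(i | Q i) (y i - a) ^+ 2.
Proof.
move=> c0 Qc; set S := \sum_(i | Q i) y i.
rewrite -subr_ge0 -sumrB.
under eq_bigr => i Qi.
  rewrite (_ : _ - _ = (2 * (c^-1 * S - a)) * y i + (a ^+ 2 - (c^-1 * S) ^+ 2) * 1);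
    last by ring.
  over.
rewrite big_split/= -!mulr_sumr Qc -/S.
suff -> : 2 * (c^-1 * S - a) * S + (a ^+ 2 - (c^-1 * S) ^+ 2) * c =
  c * (c^-1 * S - a) ^+ 2 by rewrite mulr_ge0 ?sqr_ge0// ltW.
by field; rewrite gt_eqF.
Qed.

(** The two squared weights, times the sizes of their blocks, are the proportions
    (n - s) / n and s / n, so that the conditional variance is a convex combination
    of the two block variances. *)
Lemma boot_variance_le p (x : 'I_n -> 'rV[R]_p) j (a u : R) :
  \sum_(i < n | (i < s)%N) (x i 0 j - a) ^+ 2 <= s%:R * u ->
  \sum_(i < n | (s <= i)%N) (x i 0 j - a) ^+ 2 <= (n - s)%N%:R * u ->
  \sum_(i < n) (cusum_weight i * centered x j i) ^+ 2 <= u.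
Proof.
move=> lu ru; rewrite sum_split_nat.
under eq_bigr => i si do rewrite exprMn cusum_weight_sqr /centered si !mxE summxE.
under [X in _ + X]eq_bigr => i si do
  rewrite exprMn cusum_weight_sqr /centered ltnNge si/= !mxE summxE.
rewrite -!mulr_sumr.
have -> : u = (n - s)%N%:R / (n%:R * s%:R) * (s%:R * u) +
    s%:R / (n%:R * (n - s)%N%:R) * ((n - s)%N%:R * u).
  by rewrite nE; field; rewrite -nE !gt_eqF.
apply: lerD; apply: ler_wpM2l.
- by rewrite ltW// divr_gt0// mulr_gt0.
- apply: le_trans lu; apply: sum_sqr_center_le => //.
  by rewrite sum_left_const mulr1.
- by rewrite ltW// divr_gt0// mulr_gt0.
- apply: le_trans ru; apply: sum_sqr_center_le => //.
  by rewrite sum_right_const mulr1.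
Qed.

End split_sums.

Section max_statistics.
Context (R : realType) (n p su : nat).
Implicit Types (x : 'I_n -> 'rV[R]_p) (e : 'I_n -> R) (s : nat).

Lemma test_stat_ge x s j : (su <= s <= n - su)%N ->
  `|cusum x s 0 j| <= test_stat su x.
Proof.
move=> sus; apply: le_trans (row_norm_coord _ _) _.
by apply: (@bigmax_sup_seq _ _ _ _ _ s) => //; rewrite mem_index_iota ltnS.
Qed.

Lemma boot_stat_gt e x t : 0 <= t -> t < boot_stat su e x ->
  exists s j, (su <= s <= n - su)%N /\ t < `|boot_cusum e x s 0 j|.
Proof.
move=> t0; rewrite /boot_stat ltNge => /negP tb.
have [s [sus ts]] : exists s, (su <= s <= n - su)%N /\ t < `|boot_cusum e x s|.
  apply: contrapT => /forallNP H; apply: tb; rewrite big_nat_cond.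
  apply: bigmax_le => // s; rewrite andbT ltnS => sus.
  by rewrite leNgt; apply/negP => ts; apply: (H s).
by have [j tj] := row_norm_gt t0 ts; exists s, j.
Qed.

End max_statistics.

(** * Tail bounds for the noise *)

Section union_bound.
Context d (Omega : measurableType d) (R : realType) (P : probability Omega R).

Lemma union_bound (J : finType) (Q : pred J) (E : set Omega) (F : J -> set Omega)
    (r : R) : measurable E -> (forall j, measurable (F j)) -> 0 <= r ->
  (forall j, Q j -> P (F j) <= r%:E)%E ->
  (forall w, E w -> exists2 j, Q j & F j w) ->
  (P E <= (#|J|%:R * r)%:E)%E.
Proof.
move=> mE mF r0 Fr EF.
pose h j w : R := if Q j then \1_(F j) w else 0.
have mh j : measurable_fun setT (h j) by rewrite /h; case: (Q j) => //; exact: measurable_indic.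
have h0 j w : 0 <= h j w by rewrite /h; case: ifP.
apply: (@le_trans _ _ (\int[P]_w (\sum_j h j w)%:E)%E).
  apply: prob_le_integral => //; first exact: measurable_sum.
    by move=> w; exact: sumr_ge0.
  move=> w /EF[j Qj Fj]; rewrite (bigD1 j)//= {1}/h Qj indicE mem_set//.
  by rewrite lerDl sumr_ge0.
under eq_integral do rewrite -sumEFin.
rewrite ge0_integral_sum//; last 2 first.
- by move=> j; exact/measurable_EFinP.
- by move=> j w _; rewrite lee_fin.
apply: (@le_trans _ _ (\sum_(j : J) r%:E)%E).
  apply: lee_sum => j _; rewrite /h; have [Qj|_] := boolP (Q j).
    by rewrite integral_indic// setIT Fr.
  by rewrite integral0 lee_fin.
by rewrite sumEFin sumr_const mulr_natl.
Qed.

End union_bound.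

Section noise.
Context d (Omega : measurableType d) (R : realType) (P : probability Omega R).
Context (n p : nat) (xi : 'I_n -> {RV P >-> p.-tuple R}) (v M L : R) (su : nat).
Hypotheses (indep_xi : mutually_independent P xi)
  (xi_int : forall i j, P.-integrable setT (EFin \o (fun w => tnth (xi i w) j)))
  (xi_mean : forall i j, (\int[P]_w (tnth (xi i w) j)%:E = 0)%E)
  (xi_sqr : forall i j, (\int[P]_w (tnth (xi i w) j ^+ 2)%:E <= v%:E)%E).
Hypotheses (M0 : 0 < M) (L0 : 0 < L) (su0 : (0 < su)%N)
  (suM : 6 * M ^+ 2 * L <= su%:R).

Let mtnth (j : 'I_p) : measurable_fun setT (fun x : p.-tuple R => tnth x j).
Proof. exact: measurable_tnth. Qed.

Let mxi i j : measurable_fun setT (fun w => tnth (xi i w) j).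
Proof. exact: (measurableT_comp (mtnth j)). Qed.

Let su0R : 0 < su%:R :> R. Proof. by rewrite ltr0n. Qed.

(** The boolean [b] is the sign of the deviation, and sqrt L the exponential
    parameter.  The truncation level is that of the noise, M, times the largest
    possible weight, so that it does nothing when the noise stays below M. *)
Definition noise_term (b : bool) s j (i : 'I_n) (x : p.-tuple R) : R :=
  Num.sqrt L * Num.min ((-1) ^+ b * (cusum_weight R s i * tnth x j)) (M / Num.sqrt su%:R).

(** The event that the truncated noise term exceeds (3 + 2 v) sqrt L, both sides
    being multiplied by sqrt L. *)
Definition large_noise (b : bool) s j : set Omega :=
  [set w | (3 + 2 * v) * L < \sum_(i < n) noise_term b s j i (xi i w)].

Lemma measurable_noise_term b s j i : measurable_fun setT (noise_term b s j i).
Proof.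
apply: measurable_funM => //; apply: measurable_minr => //.
by apply: measurable_funM => //; exact: measurable_funM.
Qed.

Lemma measurable_large_noise b s j : measurable (large_noise b s j).
Proof.
rewrite -[X in measurable X]setTI; apply: measurable_fun_ltr => //.
apply: measurable_sum => i; apply: measurableT_comp => //.
exact: measurable_noise_term.
Qed.

(** With squared weights summing to 1, the exponent is
    2 L v - (3 + 2 v) L = - 3 L. *)
Lemma large_noise_prob b s j : (0 < s < n)%N -> (su <= s <= n - su)%N ->
  (P (large_noise b s j) <= (expR (- (3 * L)))%:E)%E.
Proof.
move=> sn sus.
pose c (i : 'I_n) := (-1) ^+ b * cusum_weight R s i.
have cE i (x : R) : (-1) ^+ b * (cusum_weight R s i * x) = c i * x by rewrite mulrA.
have c2 i : c i ^+ 2 = cusum_weight R s i ^+ 2 by rewrite exprMn sqrr_sign mul1r.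
have sL2 : Num.sqrt L ^+ 2 = L by rewrite sqr_sqrtr// ltW.
have lB : Num.sqrt L * (M / Num.sqrt su%:R) <= 1 / 2.
  have M0' := ltW M0.
  have h : L * M ^+ 2 <= 1 / 4 * su%:R by have := su0R; have := suM; lra.
  rewrite mulrA ler_pdivrMr ?sqrtr_gt0// -ler_sqr ?nnegrE ?mulr_ge0 ?sqrtr_ge0//.
  rewrite !exprMn sL2 sqr_sqrtr ?ler0n// (_ : 1 ^+ 2 * 2^-1 ^+ 2 = 1 / 4)//.
  by field.
apply: (le_trans (chernoff_sum indep_xi (b := fun i => 2 * L * (c i ^+ 2 * v)) _ _ _)).
- exact: measurable_noise_term.
- move=> i; under eq_integral do rewrite /noise_term cE.
  rewrite -{2}sL2; apply: centered_truncated_mgf => //.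
  + by have := integrableZl measurableT (c i) (xi_int i j).
  + under eq_integral do rewrite EFinM.
    by rewrite integralZl//= ?xi_mean ?mule0//; exact: xi_int.
  + under eq_integral do rewrite exprMn EFinM.
    rewrite ge0_integralZl//=; last 3 first.
    * by apply/measurable_EFinP; exact: measurable_funX.
    * by move=> w _; rewrite lee_fin sqr_ge0.
    * by rewrite ?lee_fin sqr_ge0.
    by rewrite [leRHS]EFinM lee_wpmul2l// lee_fin sqr_ge0.
  + by rewrite divr_ge0 ?sqrtr_ge0// ltW.
- rewrite lee_fin ler_expR -mulr_sumr -mulr_suml.
  under eq_bigr do rewrite c2.
  by rewrite (sum_cusum_weight_sqr R sn); lra.
Qed.

Lemma noise_le w s j : (0 < s < n)%N -> (su <= s <= n - su)%N ->
  (forall i j, `|tnth (xi i w) j| <= M) -> (forall b, ~ large_noise b s j w) ->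
  `|\sum_(i < n) cusum_weight R s i * tnth (xi i w) j| <= (3 + 2 * v) * Num.sqrt L.
Proof.
move=> sn sus xiM nl.
have sL : 0 < Num.sqrt L by rewrite sqrtr_gt0.
have sL2 : L = Num.sqrt L * Num.sqrt L by rewrite -expr2 sqr_sqrtr// ltW.
set S := \sum_(i < n) _.
have Sb (b : bool) : (-1) ^+ b * S <= (3 + 2 * v) * Num.sqrt L.
  rewrite -(ler_pM2l sL) [leRHS]mulrCA -sL2 leNgt; apply/negP => h; apply: (nl b).
  rewrite /large_noise/=; apply: lt_le_trans h _.
  rewrite /S !mulr_sumr; apply: ler_sum => i _; rewrite ler_pM2l// le_min lexx /=.
  apply: le_trans (ler_norm _) _; rewrite normrM normr_sign mul1r normrM mulrC.
  rewrite ler_pM//.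
  rewrite -ler_sqr ?nnegrE ?invr_ge0 ?sqrtr_ge0// real_normK ?num_real//.
  by rewrite exprVn sqr_sqrtr ?ler0n// cusum_weight_sqr_le.
by rewrite ler_norml lerNl; have := Sb true; have := Sb false;
  rewrite expr1 mulN1r expr0 mul1r => -> ->.
Qed.

Definition block (right : bool) s : pred 'I_n :=
  fun i => if right then (s <= i)%N else (i < s)%N.
Definition block_size (right : bool) s : R := if right then (n - s)%N%:R else s%:R.

(** The event that the average over a block of the truncated squares exceeds
    2 v + 1, multiplied by the exponential parameter 1 / (2 M^2), the largest
    allowed for variables truncated at M^2. *)
Definition large_square b s j : set Omega :=
  [set w | block_size b s * (2 * v + 1) / (2 * M ^+ 2) <
    \sum_(i < n) (if block b s i then (2 * M ^+ 2)^-1 *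
      Num.min (tnth (xi i w) j ^+ 2) (M ^+ 2) else 0)].

Lemma sum_block_const b s (c : R) : (0 < s < n)%N ->
  \sum_(i < n) (if block b s i then c else 0) = block_size b s * c.
Proof.
move=> sn; rewrite -big_mkcond/=; case: b; first exact: sum_right_const.
exact: sum_left_const.
Qed.

Lemma measurable_large_square b s j : measurable (large_square b s j).
Proof.
rewrite -[X in measurable X]setTI; apply: measurable_fun_ltr => //.
apply: measurable_sum => i; case: (block b s i) => //.
apply: measurable_funM => //; apply: measurable_minr => //.
exact: measurable_funX.
Qed.

(** The exponent is minus the block size over 2 M^2, and blocks contain at least
    [su] >= 6 M^2 L indices. *)
Lemma large_square_prob b s j : (0 < s < n)%N -> (su <= s <= n - su)%N ->
  (P (large_square b s j) <= (expR (- (3 * L)))%:E)%E.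
Proof.
move=> sn sus; set l := (2 * M ^+ 2)^-1.
have M20 : 0 < M ^+ 2 by rewrite exprn_gt0.
have l0 : 0 < l by rewrite invr_gt0 mulr_gt0.
have subs : su%:R <= block_size b s.
  by rewrite /block_size; case: b; rewrite ler_nat; lia.
apply: (le_trans (chernoff_sum indep_xi
  (g := fun i x => if block b s i then l * Num.min (tnth x j ^+ 2) (M ^+ 2) else 0)
  (b := fun i => if block b s i then 2 * l * v else 0) _ _ _)).
- move=> i; case: (block b s i) => //; apply: measurable_funM => //.
  by apply: measurable_minr => //; exact: measurable_funX.
- move=> i; case: (block b s i); last first.
    by rewrite expR0 integral_probability_cst.
  apply: nonneg_truncated_mgf => //.
  + exact: measurable_funX.
  + by move=> w; exact: sqr_ge0.
  + exact: ltW.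
  + exact: ltW.
  + by rewrite /l le_eqVlt; apply/orP; left; apply/eqP; field; rewrite gt_eqF.
rewrite lee_fin ler_expR sum_block_const//.
have -> : block_size b s * (2 * l * v) - block_size b s * (2 * v + 1) * l =
  - (block_size b s * l) by ring.
rewrite lerN2; apply: (@le_trans _ _ (su%:R * l)); last by rewrite ler_pM2r.
by rewrite /l ler_pdivlMr ?mulr_gt0//; have := suM; lra.
Qed.

Lemma sum_square_le b w s j : (0 < s < n)%N ->
  (forall i j, `|tnth (xi i w) j| <= M) -> ~ large_square b s j w ->
  \sum_(i < n | block b s i) tnth (xi i w) j ^+ 2 <= block_size b s * (2 * v + 1).
Proof.
move=> sn xiM; rewrite /large_square/= -big_mkcond/= -mulr_sumr.
have M20 : 0 < 2 * M ^+ 2 by rewrite mulr_gt0 ?exprn_gt0.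
move=> /negP; rewrite -leNgt mulrC ler_pM2r ?invr_gt0//; apply: le_trans.
apply: ler_sum => i _; rewrite le_min lexx /= -real_normK ?num_real//.
by rewrite lerXn2r// nnegrE// ltW.
Qed.

End noise.

(** * Power of the bootstrap test *)

Section measurable_statistics.
Context d (U : measurableType d) (R : realType) (n p : nat).
Variable x : 'I_n -> U -> 'rV[R]_p.
Hypothesis mx : forall i j, measurable_fun setT (fun w => x i w 0 j).

Lemma measurable_sum_ord (Q : pred 'I_n) (F : 'I_n -> U -> R) :
  (forall i, measurable_fun setT (F i)) ->
  measurable_fun setT (fun w => \sum_(i < n | Q i) F i w).
Proof.
by move=> mF; under eq_fun do rewrite -big_filter; exact: measurable_sum.
Qed.

Lemma measurable_mean_left s j : measurable_fun setT (fun w => mean_left (x ^~ w) s 0 j).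
Proof.
under eq_fun do rewrite !mxE summxE.
by apply: measurable_funM => //; exact: measurable_sum_ord.
Qed.

Lemma measurable_mean_right s j : measurable_fun setT (fun w => mean_right (x ^~ w) s 0 j).
Proof.
under eq_fun do rewrite !mxE summxE.
by apply: measurable_funM => //; exact: measurable_sum_ord.
Qed.

Lemma measurable_centered s j i : measurable_fun setT (fun w => centered s (x ^~ w) j i).
Proof.
rewrite /centered; case: (i < s)%N; apply: measurable_funB => //.
  exact: measurable_mean_left.
exact: measurable_mean_right.
Qed.

Lemma measurable_test_stat su : measurable_fun setT (fun w => test_stat su (x ^~ w)).
Proof.
apply: measurable_bigmax => s; apply: measurable_row_norm => j.
rewrite (_ : (fun w => _) = fun w => Num.sqrt (s%:R * (n - s)%N%:R / n%:R) *
    (mean_left (x ^~ w) s 0 j - mean_right (x ^~ w) s 0 j)); last first.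
  by apply/funext => w; rewrite !mxE.
apply: measurable_funM => //; apply: measurable_funB.
  exact: measurable_mean_left.
exact: measurable_mean_right.
Qed.

Lemma measurable_boot_stat su (e : 'I_n -> U -> R) :
  (forall i, measurable_fun setT (e i)) ->
  measurable_fun setT (fun w => boot_stat su (e ^~ w) (x ^~ w)).
Proof.
move=> me; apply: measurable_bigmax => s; apply: measurable_row_norm => j.
rewrite (_ : (fun w => _) = fun w => Num.sqrt ((n - s)%N%:R / (n%:R * s%:R)) *
      (\sum_(i < n | (i < s)%N) e i w * (x i w 0 j - mean_left (x ^~ w) s 0 j)) -
    Num.sqrt (s%:R / (n%:R * (n - s)%N%:R)) *
      (\sum_(i < n | (s <= i)%N) e i w * (x i w 0 j - mean_right (x ^~ w) s 0 j))).
  apply: measurable_funB; apply: measurable_funM => //;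
    apply: measurable_sum_ord => i; apply: measurable_funM => //;
    apply: measurable_funB => //.
    exact: measurable_mean_left.
  exact: measurable_mean_right.
apply/funext => w; rewrite !mxE !summxE.
by congr (_ * _ - _ * _); apply: eq_bigr => i _; rewrite !mxE ?summxE.
Qed.

End measurable_statistics.

Lemma log_np_ge1 (R : realType) (n p : nat) : (4 <= n)%N -> (3 <= p)%N ->
  1 <= log_np R n p.
Proof.
move=> n4 p3; rewrite /log_np -[leLHS]expRK ler_ln ?posrE ?expR_gt0//; last first.
  by rewrite ltr0n; nia.
apply: (@le_trans _ _ 4%:R); last by rewrite ler_nat; nia.
have -> : expR 1 = expR (1 / 2) ^+ 2 :> R by rewrite -expRM_natl; congr expR; field.
have h : expR (1 / 2) <= 2 :> R by apply: le_trans (expR_le_affine _) _; lra.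
have -> : 4%:R = 2 ^+ 2 :> R by ring.
by rewrite lerXn2r ?nnegrE ?expR_ge0.
Qed.

Section power.
Context d (Omega : measurableType d) (R : realType) (P : probability Omega R).
Context (n p su m : nat) (mu delta : 'rV[R]_p).
Variables (xi : 'I_n -> {RV P >-> p.-tuple R}) (v M : R).
Hypotheses (su0 : (0 < su)%N) (sum : (su <= m <= n - su)%N) (d1 : `|delta| <= 1).

Let X := mean_shift mu delta m xi.
Let x w i := vec (X i w).

Lemma mean_shift_coord w i j :
  x w i 0 j = mu 0 j + (if (m <= i)%N then delta 0 j else 0) + tnth (xi i w) j.
Proof. by rewrite /x /X mxE tnth_mktuple. Qed.

Lemma measurable_mean_shift i : measurable_fun setT (X i).
Proof.
apply/measurable_fun_tnthP => j.
rewrite (_ : _ \o _ = fun w => mu 0 j + (if (m <= i)%N then delta 0 j else 0) +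
  tnth (xi i w) j); last by apply/funext => w /=; rewrite tnth_mktuple.
apply: measurable_funD => //; apply: (measurableT_comp (measurable_tnth j)).
exact: measurable_funPT.
Qed.

Let range_interior s : (su <= s <= n - su)%N -> (0 < s < n)%N.
Proof. by have := su0; lia. Qed.

(** The weights sum to 0, so the common mean disappears; over the indices after the
    change they sum to minus the square root of m (n - m) / n. *)
Lemma test_stat_signal w (c : R) : (0 < p)%N ->
  (forall j, `|\sum_(i < n) cusum_weight R m i * tnth (xi i w) j| <= c) ->
  Num.sqrt (m%:R * (n - m)%N%:R / n%:R) * `|delta| - c <= test_stat su (x w).
Proof.
move=> p0 xic; have mn := range_interior sum.
have [j dj] := row_norm_attained delta p0.
apply: le_trans (test_stat_ge _ j sum); rewrite -dj (cusumE mn).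
set r := Num.sqrt _; set S := \sum_(i < n) cusum_weight R m i * x w i 0 j.
have -> : S = \sum_(i < n) cusum_weight R m i * tnth (xi i w) j - r * delta 0 j.
  rewrite /S; under eq_bigr do rewrite mean_shift_coord !mulrDr.
  rewrite !big_split/= -mulr_suml (sum_cusum_weight _ mn) mul0r add0r addrC.
  congr (_ + _); rewrite -mulNr -(sum_cusum_weight_right _ mn) mulr_suml [RHS]big_mkcond/=.
  by apply: eq_bigr => i _; case: ifP => _; rewrite ?mulr0.
rewrite distrC; apply: le_trans (lerB_dist _ _); rewrite normrM ger0_norm ?sqrtr_ge0//.
by rewrite lerD2l lerN2.
Qed.

(** Centring both blocks at [mu] leaves squares of the shift, at most 1, and of the
    noise: 2 + 2 (2 v + 1) = 4 (1 + v). *)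
Lemma boot_variance_good w s j : 0 <= v -> (su <= s <= n - su)%N ->
  (forall b, \sum_(i < n | block b s i) tnth (xi i w) j ^+ 2 <= block_size R n b s * (2 * v + 1)) ->
  \sum_(i < n) (cusum_weight R s i * centered s (x w) j i) ^+ 2 <= 4 * (1 + v).
Proof.
move=> v0 sus xis; have sn := range_interior sus.
have dj : `|delta 0 j| <= 1 by exact: le_trans (row_norm_coord _ _) d1.
have xle i : (x w i 0 j - mu 0 j) ^+ 2 <= 2 + 2 * tnth (xi i w) j ^+ 2.
  rewrite mean_shift_coord; set a := (if _ then _ else _); set z := tnth _ _.
  have -> : mu 0 j + a + z - mu 0 j = a + z by ring.
  have a1 : a ^+ 2 <= 1.
    rewrite /a; case: ifP => _; last by rewrite expr0n/=.
    by rewrite -real_normK ?num_real// exprn_ile1.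
  have : 0 <= (a - z) ^+ 2 by exact: sqr_ge0.
  by lra.
have blk b : \sum_(i < n | block b s i) (x w i 0 j - mu 0 j) ^+ 2 <=
    block_size R n b s * (4 * (1 + v)).
  apply: (@le_trans _ _ (\sum_(i < n | block b s i) (2 + 2 * tnth (xi i w) j ^+ 2))).
    by apply: ler_sum => i _; exact: xle.
  rewrite big_split/= -mulr_sumr big_mkcond/= sum_block_const//.
  by have := xis b; lra.
by apply: (boot_variance_le sn (a := mu 0 j)); [exact: (blk false)|exact: (blk true)].
Qed.

Hypotheses (v0 : 0 <= v) (M0 : 0 < M) (n4 : (4 <= n)%N) (p3 : (3 <= p)%N).
Hypotheses (indep_xi : mutually_independent P xi)
  (xi_int : forall i j, P.-integrable setT (EFin \o (fun w => tnth (xi i w) j)))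
  (xi_mean : forall i j, (\int[P]_w (tnth (xi i w) j)%:E = 0)%E)
  (xi_sqr : forall i j, (\int[P]_w (tnth (xi i w) j ^+ 2)%:E <= v%:E)%E).
Let L : R := log_np R n p.
Hypothesis suM : 6 * M ^+ 2 * L <= su%:R.

(** A maximum over pairs, with the value 0 outside the range of [s], rather than a
    universal statement: measurability in the data is then immediate. *)
Definition good_data : set Omega :=
  [set w | \big[Num.max/0]_(z : 'I_n * 'I_p) (if (su <= z.1 <= n - su)%N then
     \sum_(i < n) (cusum_weight R z.1 i * centered z.1 (x w) z.2 i) ^+ 2 else 0) <= 4 * (1 + v)].

Let FX : measurableType _ := g_sigma_algebraType (g_sigma_preimage X).

Let mxFX i j : measurable_fun setT (fun w : FX => x w i 0 j).
Proof.
rewrite (_ : (fun w => _) = (fun y : p.-tuple R => tnth y j) \o X i).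
  apply: (measurableT_comp (measurable_tnth j)).
  exact: (measurable_fun_sigma_preimage (X := X)).
by apply/funext => w; rewrite /x mxE.
Qed.

Let mx i j : measurable_fun setT (fun w : Omega => x w i 0 j).
Proof. by apply: (measurable_fun_coarsen measurable_mean_shift); exact: mxFX. Qed.

Lemma good_data_measurable : g_sigma_preimage X good_data.
Proof.
rewrite -measurable_sigma_preimageE -[X in measurable X]setTI.
apply: measurable_fun_ler => //; apply: measurable_bigmax => -[s j]/=.
case: (su <= s <= n - su)%N => //; apply: measurable_sum => i; apply: measurable_funX.
apply: measurable_funM => //.
exact: (@measurable_centered _ FX R n p (fun i w => x w i) mxFX s j i).
Qed.

Lemma good_dataP w s j : good_data w -> (su <= s <= n - su)%N ->
  \sum_(i < n) (cusum_weight R s i * centered s (x w) j i) ^+ 2 <= 4 * (1 + v).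
Proof.
move=> Gw sus; have /andP[_ sn] := range_interior sus.
apply: le_trans Gw.
apply: (@bigmax_sup _ _ _ _ (Ordinal sn, j)) => //=.
by rewrite sus.
Qed.

Let L1 : 1 <= L. Proof. exact: log_np_ge1. Qed.

(** There are 2p noise events and at most 2np events about squares, each of
    probability at most (np)^-3. *)
Lemma bad_noise_prob :
  exists B : set Omega, [/\ measurable B,
    (P B <= (4 * ((n * p)%:R ^- 2))%:E)%E &
    forall w, (forall i j, `|tnth (xi i w) j| <= M) -> ~ B w ->
      (forall j, `|\sum_(i < n) cusum_weight R m i * tnth (xi i w) j| <=
         (3 + 2 * v) * Num.sqrt L) /\ good_data w].
Proof.
have L0 : 0 < L by apply: lt_le_trans L1.
have n0 : (0 < n)%N by exact: leq_trans n4.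
have p0 : (0 < p)%N by exact: leq_trans p3.
have [N NE] : {N : R | N = (n * p)%:R} by exists (n * p)%:R.
have N0 : 0 < N by rewrite NE ltr0n muln_gt0 n0.
have e3 : expR (- (3 * L)) = N ^- 3 by rewrite expRN expRM_natl lnK -?NE.
rewrite -NE.
pose Q (z : bool * 'I_n * 'I_p) := (su <= z.1.2 <= n - su)%N.
pose LN (z : bool * 'I_p) := large_noise xi v M L su z.1 m z.2.
pose LS (z : bool * 'I_n * 'I_p) := large_square xi v M z.1.1 z.1.2 z.2.
have mLN z : measurable (LN z) by exact: measurable_large_noise.
have mLS z : measurable (LS z) by exact: measurable_large_square.
pose B1 := \bigcup_(z in [set: bool * 'I_p]) LN z.
pose B2 := \bigcup_(z in [set z | Q z]) LS z.
have mB1 : measurable B1 by exact: fin_bigcup_measurable.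
have mB2 : measurable B2 by exact: fin_bigcup_measurable.
exists (B1 `|` B2); split; first exact: measurableU.
  apply: le_trans (measureU2 _ mB1 mB2) _.
  have e0 : 0 <= N ^- 3 by rewrite invr_ge0 exprn_ge0// ltW.
  have PB1 : (P B1 <= (#|{: bool * 'I_p}|%:R * N ^- 3)%:E)%E.
    apply: (union_bound (Q := xpredT) (F := LN)) => //.
      move=> z _; rewrite -e3; apply: large_noise_prob => //.
      exact: range_interior.
    by move=> w [z _ LNz]; exists z.
  have PB2 : (P B2 <= (#|{: bool * 'I_n * 'I_p}|%:R * N ^- 3)%:E)%E.
    apply: (union_bound (Q := Q) (F := LS)) => //.
    by move=> z Qz; rewrite -e3; apply: (large_square_prob (su := su)) => //;
      exact: range_interior.
  apply: le_trans (leeD PB1 PB2) _.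
  rewrite -EFinD lee_fin !card_prod card_bool !card_ord -mulrDl -natrD.
  rewrite [leLHS](_ : _ = (2 * p + 2 * n * p)%N%:R / N * N ^- 2); last first.
    by field; rewrite gt_eqF.
  apply: ler_wpM2r; first by rewrite invr_ge0 exprn_ge0// ltW.
  rewrite ler_pdivrMr// NE -natrM ler_nat.
  by have := n0; nia.
move=> w xiM nB; split.
  move=> j; apply: (noise_le (su := su) (M := M)) => //; first exact: range_interior.
  by move=> b Lb; apply: nB; left; exists (b, j).
apply: bigmax_le => [|[s j] _ /=]; first by rewrite mulr_ge0// addr_ge0.
case: ifP => sus; last by rewrite mulr_ge0// addr_ge0.
apply: boot_variance_good => // b; apply: (sum_square_le (M := M)) => //.
  exact: range_interior.
by move=> Lb; apply: nB; right; exists ((b, s), j).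
Qed.

Variables (e : 'I_n -> {RV P >-> R}) (k : R.-pker FX ~> R) (alpha : R).
Let Tstar w := boot_stat su (fun i => e i w) (x w).
Hypotheses (boot : bootstrap_multipliers X e)
  (kP : regular_conditional_law P Tstar k) (alpha01 : 0 < alpha < 1).
Let La : R := ln ((n * p)%:R / alpha).
Let t0 : R := 4 * Num.sqrt (1 + v) * Num.sqrt La.

Let N0 : 0 < (n * p)%:R :> R.
Proof. by rewrite ltr0n; have := n4; have := p3; nia. Qed.

Let LLa : L <= La.
Proof.
case/andP: alpha01 => a0 a1; rewrite /L /La /log_np ler_ln ?posrE ?divr_gt0//.
by rewrite ler_pdivlMr// ler_piMr// ltW.
Qed.

Let La1 : 1 <= La. Proof. exact: le_trans L1 LLa. Qed.

Let mTstar : measurable_fun setT Tstar.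
Proof.
apply: (@measurable_boot_stat _ Omega R n p (fun i w => x w i) mx su (fun i w => e i w)).
by move=> i; exact: measurable_funPT.
Qed.

(** The threshold t0 is chosen so that t0^2 / (2 * 4 (1 + v)) = 2 La, which makes
    each tail at most (alpha / np)^2: the union bound over 2np tails then stays
    below alpha. *)
Lemma boot_tail (A : set Omega) : g_sigma_preimage X A -> A `<=` good_data ->
  (P (A `&` [set w | (t0 < Tstar w)%R]) <= (2 * alpha ^+ 2 / (n * p)%:R)%:E * P A)%E.
Proof.
move=> FA AG; case: boot => indepe normale indep.
have v1 : 0 < 1 + v by have := v0; lra.
have La0 : 0 < La by have := La1; lra.
have t00 : 0 < t0 by rewrite /t0 !mulr_gt0 ?sqrtr_gt0.
pose c (z : 'I_n * 'I_p) (i : 'I_n) w :=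
  cusum_weight R z.1 i * centered z.1 (x w) z.2 i.
have mc z i : measurable_fun setT (c z i : FX -> R).
  apply: measurable_funM => //.
  exact: (@measurable_centered _ FX R n p (fun i w => x w i) mxFX z.1 z.2 i).
apply: (@le_trans _ _ ((2 * #|{: 'I_n * 'I_p}|%:R *
    expR (- (t0 ^+ 2 / (2 * (4 * (1 + v))))))%:E * P A)%E).
  have tail := conditional_gaussian_max_tail (E := [set w | (t0 < Tstar w)%R])
    measurable_mean_shift indepe normale indep (s := 4 * (1 + v))
    (Q := fun z : 'I_n * 'I_p => (su <= z.1 <= n - su)%N) _ t00 FA mc.
  apply: tail.
  - by rewrite mulr_gt0.
  - by move=> w z Aw zs; apply: good_dataP => //; exact: AG.
  - by rewrite -[X in measurable X]setTI; exact: measurable_fun_ltr.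
  - move=> w /= tw; have [s [j [sus tsj]]] := boot_stat_gt (ltW t00) tw.
    have sn := range_interior sus; have /andP[_ sn'] := sn.
    by exists (Ordinal sn', j) => //=; rewrite -boot_cusumE.
rewrite lee_wpmul2r// lee_fin card_prod !card_ord.
have -> : t0 ^+ 2 / (2 * (4 * (1 + v))) = 2%:R * La.
  rewrite /t0 !exprMn !sqr_sqrtr; [|exact: ltW|exact: ltW].
  by field; rewrite gt_eqF.
case/andP: alpha01 => a0 a1.
rewrite expRN expRM_natl lnK ?posrE ?divr_gt0//.
move: N0; move: ((n * p)%:R : R) => N N_gt0.
rewrite le_eqVlt; apply/orP; left; apply/eqP.
by field; rewrite !gt_eqF.
Qed.

Lemma bootstrap_quantile_good : exists A : set Omega,
  [/\ measurable A, P A = 0%E &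
   forall w, good_data w -> ~ A w -> quantile (k w) (1 - alpha) <= t0].
Proof.
case/andP: (alpha01) => a0 a1.
have [|FA PA] := conditional_tail_negligible measurable_mean_shift mTstar kP
    good_data_measurable _ boot_tail (a := alpha).
  rewrite ltr_pdivrMr// expr2 mulrA [ltRHS]mulrC ltr_pM2r//.
  have : (12%:R : R) <= (n * p)%:R by rewrite ler_nat; have := n4; have := p3; nia.
  by lra.
eexists; split; [exact: (sigma_preimage_measurable measurable_mean_shift FA)|exact: PA|].
move=> w Gw nA; apply: kernel_quantile_le; first by lra.
by rewrite leNgt; apply/negP => kw; apply: nA.
Qed.

Variable eta : R.
Hypotheses (noise_bounded :
    (P [set w | exists i j, (M < `|tnth (xi i w) j|)%R] <= eta%:E)%E)
  (signal : (4 * Num.sqrt (1 + v) + 4 + 2 * v) * Num.sqrt La <=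
     Num.sqrt (m%:R * (n - m)%N%:R / n%:R) * `|delta|).

Lemma measurable_noise_exceeds : measurable [set w | exists i j, M < `|tnth (xi i w) j|].
Proof.
rewrite (_ : [set w | _] = \bigcup_(z in [set: 'I_n * 'I_p])
   [set w | M < `|tnth (xi z.1 w) z.2|]).
  apply: fin_bigcup_measurable => // z _; rewrite -[X in measurable X]setTI.
  apply: measurable_fun_ltr => //; apply: measurableT_comp => //.
  by apply: (measurableT_comp (measurable_tnth z.2)); exact: measurable_funPT.
apply/seteqP; split => w /=; first by move=> [i [j h]]; exists (i, j).
by move=> [[i j] _ /= h]; exists i, j.
Qed.

Lemma bootstrap_test_power :
  ((1 - eta - 4 * (n * p)%:R ^- 2)%:E <=
   P [set w : Omega | (quantile (k w) (1 - alpha) < test_stat su (x w))%R])%E.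
Proof.
set Ev := [set w : Omega | _].
have mEv : measurable Ev.
  apply: (measurable_quantile_lt measurable_mean_shift); first by have := alpha01; lra.
  exact: (@measurable_test_stat _ Omega R n p (fun i w => x w i) mx su).
have [A [mA PA qA]] := bootstrap_quantile_good.
have [B [mB PB hB]] := bad_noise_prob.
have := noise_bounded; set E := [set w | exists i j, _] => PE.
have mE : measurable E by exact: measurable_noise_exceeds.
have p0 : (0 < p)%N by exact: leq_trans p3.
(* Failure to reject requires large noise, a bad noise event, or the null event on
   which the quantile bound fails. *)
have EvC : ~` Ev `<=` E `|` (B `|` A).
  move=> w; apply: contra_notP => /not_orP[nE /not_orP[nB nA]].
  have xiM i j : `|tnth (xi i w) j| <= M.
    by rewrite leNgt; apply/negP => h; apply: nE; exists i, j.
  have [xic Gw] := hB w xiM nB.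
  rewrite /Ev/=; apply: le_lt_trans (qA w Gw nA) _.
  apply: lt_le_trans (test_stat_signal p0 xic).
  have sL : Num.sqrt L <= Num.sqrt La by rewrite ler_wsqrtr.
  have sLa : 0 < Num.sqrt La by rewrite sqrtr_gt0; have := La1; lra.
  have : (3 + 2 * v) * Num.sqrt L <= (3 + 2 * v) * Num.sqrt La.
    by rewrite ler_wpM2l//; have := v0; lra.
  by have := signal; rewrite /t0; lra.
have PEvC : (P (~` Ev) <= eta%:E + (4 * (n * p)%:R ^- 2)%:E)%E.
  apply: (@le_trans _ _ (P (E `|` (B `|` A)))).
    apply: le_measure => //; rewrite inE; first exact: measurableC.
    by apply: measurableU => //; exact: measurableU.
  apply: le_trans (measureU2 _ mE (measurableU _ _ mB mA)) _.
  apply: leeD => //; apply: (@le_trans _ _ (P B + P A)%E); first exact: measureU2.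
  by rewrite PA adde0.
have : P (~` Ev) = (1 - P Ev)%E by exact: probability_setC.
have /fineK : P Ev \is a fin_num by rewrite fin_num_measure.
move=> <- PEvE; move: PEvC; rewrite PEvE -[X in (X - _ <= _)%E]/(1%:E) -EFinB -EFinD.
by rewrite !lee_fin; lra.
Qed.

End power.

(** * Truncation levels *)

Section truncation_levels.
Context d (Omega : measurableType d) (R : realType) (P : probability Omega R).

(** The infimum defining the norm need not be attained; doubling [b] leaves room for
    an admissible c < 2 b, for which E exp(|Y| / c) <= 2. *)
Lemma psi1_tail (Y : Omega -> R) (b t : R) : measurable_fun setT Y -> 0 < b -> 0 <= t ->
  (psi1_norm P Y <= b%:E)%E ->
  (P [set w | (t < `|Y w|)%R] <= (2 * expR (- (t / (2 * b))))%:E)%E.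
Proof.
move=> mY b0 t0 Yb.
have : (psi1_norm P Y < (2 * b)%:E)%E by apply: le_lt_trans Yb _; rewrite lte_fin; lra.
move=> /ereal_inf_lt[_ [c [c0 Ec] <-]]; rewrite lte_fin => cb.
have mexp : measurable_fun setT (fun w => expR (`|Y w| / c)).
  apply: measurableT_comp => //; apply: measurable_funM => //.
  exact: measurableT_comp.
have exp1 w : 1 <= expR (`|Y w| / c).
  by rewrite -[leLHS]expR0 ler_expR divr_ge0// ltW.
have E2 : (\int[P]_w (expR (`|Y w| / c))%:E <= 2%:E)%E.
  have -> : (\int[P]_w (expR (`|Y w| / c))%:E =
      \int[P]_w ((expR (`|Y w| / c) - 1)%:E + 1%:E))%E.
    by apply: eq_integral => w _; rewrite -EFinD subrK.
  rewrite ge0_integralD//=; last 2 first.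
  - by move=> w _; rewrite lee_fin subr_ge0.
  - by apply/measurable_EFinP; exact: measurable_funB.
  rewrite integral_probability_cst (_ : 2%:E = 1%:E + 1%:E)%E; last by rewrite -EFinD.
  by rewrite leeD2r//; move: Ec; rewrite unlock.
apply: (@le_trans _ _ (\int[P]_w (expR (- (t / c)) * expR (`|Y w| / c))%:E)%E).
  apply: prob_le_integral => //.
  - rewrite -[X in measurable X]setTI; apply: measurable_fun_ltr => //.
    exact: measurableT_comp.
  - exact: measurable_funM.
  - move=> w /= tY; rewrite -expRD -[leLHS]expR0 ler_expR addrC subr_ge0.
    by rewrite ler_pM2r ?invr_gt0// ltW.
under eq_integral do rewrite EFinM.
rewrite ge0_integralZl//; last exact/measurable_EFinP.
apply: (@le_trans _ _ ((expR (- (t / c)))%:E * 2%:E)%E).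
  by rewrite lee_wpmul2l// lee_fin expR_ge0.
rewrite -EFinM lee_fin mulrC ler_wpM2l// ler_expR lerN2 ler_wpM2l//.
by rewrite lef_pV2 ?posrE ?mulr_gt0// ltW.
Qed.

Context (n p : nat) (xi : 'I_n -> {RV P >-> p.-tuple R}).

Let mxi i j : measurable_fun setT (fun w => tnth (xi i w) j).
Proof.
by apply: (measurableT_comp (measurable_tnth j)); exact: measurable_funPT.
Qed.

Lemma psi1_noise_exceeds (b t : R) : 0 < b -> 0 <= t -> condC P b xi ->
  (P [set w | exists i j, (t < `|tnth (xi i w) j|)%R] <=
   ((n * p)%:R * (2 * expR (- (t / (2 * b)))))%:E)%E.
Proof.
move=> b0 t0 xib.
rewrite -[in (n * p)%N](card_ord n) -[in (#|_| * p)%N](card_ord p) -card_prod.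
apply: (union_bound (Q := xpredT)
  (F := fun z : 'I_n * 'I_p => [set w | t < `|tnth (xi z.1 w) z.2|])).
- exact: measurable_noise_exceeds.
- move=> z; rewrite -[X in measurable X]setTI; apply: measurable_fun_ltr => //.
  exact: measurableT_comp.
- by rewrite mulr_ge0 ?expR_ge0.
- by move=> [i j] _ /=; apply: psi1_tail.
- by move=> w [i [j h]]; exists (i, j).
Qed.

(** Markov's inequality for the q-th power of the maximum over coordinates gives
    gamma / n for each index i, so that the union bound is over i only. *)
Lemma max_moment_noise_exceeds (b q gamma : R) : (0 < n)%N -> 0 < b -> 0 < q ->
  0 < gamma -> condD P b q xi ->
  (P [set w | exists i j, (b * (n%:R / gamma) `^ q^-1 < `|tnth (xi i w) j|)%R] <=
   gamma%:E)%E.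
Proof.
move=> n0 b0 q0 g0 xib.
have n0R : 0 < n%:R :> R by rewrite ltr0n.
rewrite [leRHS](_ : _ = (#|'I_n|%:R * (gamma / n%:R))%:E); last first.
  by rewrite card_ord mulrC divfK// gt_eqF.
pose F i := [set w | exists j, b * (n%:R / gamma) `^ q^-1 < `|tnth (xi i w) j|].
have mF i : measurable (F i).
  rewrite (_ : F i = \bigcup_(j in [set: 'I_p])
     [set w | b * (n%:R / gamma) `^ q^-1 < `|tnth (xi i w) j|]).
    apply: fin_bigcup_measurable => // j _; rewrite -[X in measurable X]setTI.
    by apply: measurable_fun_ltr => //; exact: measurableT_comp.
  by apply/seteqP; split => w /=; [move=> [j ?]; exists j|move=> [j _ ?]; exists j].
apply: (union_bound (Q := xpredT) (F := F)) => //; last 2 first.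
- move=> i _.
  pose h w := \big[Num.max/0]_(j < p) (`|tnth (xi i w) j| / b) `^ q.
  have mh : measurable_fun setT h.
    apply: measurable_bigmax => j; apply: (measurableT_comp (measurable_powR q)).
    by apply: measurable_funM => //; exact: measurableT_comp.
  have h0 w : 0 <= h w by exact: bigmax_ge_id.
  apply: (@le_trans _ _ (\int[P]_w (gamma / n%:R * h w)%:E)%E).
    apply: prob_le_integral => //.
    + exact: measurable_funM.
    + by move=> w; rewrite mulr_ge0// divr_ge0// ltW.
    + move=> w [j tj].
      have hj : n%:R / gamma <= h w.
        apply: (@bigmax_sup _ _ _ _ j) => //.
        have -> : n%:R / gamma = ((n%:R / gamma) `^ q^-1) `^ q.
          by rewrite -powRrM mulVf ?gt_eqF// powRr1// divr_ge0// ltW.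
        apply: ge0_ler_powR; rewrite ?nnegrE ?powR_ge0 ?divr_ge0 ?(ltW q0) ?(ltW b0)//.
        by rewrite ler_pdivlMr// mulrC ltW.
      apply: (@le_trans _ _ (gamma / n%:R * (n%:R / gamma))).
        by rewrite mulrA divfK ?divff// gt_eqF.
      by rewrite ler_wpM2l// divr_ge0// ltW.
  under eq_integral do rewrite EFinM.
  rewrite ge0_integralZl//; last 3 first.
  + exact/measurable_EFinP.
  + by move=> w _; rewrite lee_fin.
  + by rewrite lee_fin divr_ge0// ltW.
  rewrite -[leRHS]mule1 lee_wpmul2l// ?lee_fin ?divr_ge0 ?(ltW g0)//.
  by have := xib i; rewrite unlock.
- by move=> w [i [j h]]; exists i => //; exists j.
- exact: measurable_noise_exceeds.
- by rewrite divr_ge0// ltW.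
Qed.

End truncation_levels.

(** For numbers in ]0, 1] a power at most 1 only increases the value; this gives
    crude lower bounds on the rates that do not depend on their exponents. *)
Lemma powR_ge_ratio (R : realType) (D y r : R) : 1 <= D -> 0 < r <= 1 ->
  D^-1 <= y -> D^-1 <= y `^ r.
Proof.
move=> D1 /andP[r0 r1] Dy; have D0 : 0 < D by lra.
have Dinv : 0 < D^-1 <= 1 by rewrite invr_gt0 D0 invf_le1.
apply: le_trans (ger1_powR Dinv r1) _.
apply: ge0_ler_powR => //; rewrite ?nnegrE; first exact: ltW.
  by rewrite invr_ge0 ltW.
by apply: le_trans Dy; rewrite invr_ge0 ltW.
Qed.

Section rates.
Context (R : realType) (n p su : nat).
Hypotheses (n4 : (4 <= n)%N) (p3 : (3 <= p)%N) (su0 : (0 < su)%N) (sun : (su <= n)%N).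
Let L : R := log_np R n p.

Let L1 : 1 <= L. Proof. exact: log_np_ge1. Qed.
Let su0R : 0 < su%:R :> R. Proof. by rewrite ltr0n. Qed.

Lemma rate1_ge_ratio (D : R) : 1 <= D -> su%:R <= D * L ^+ 3 -> D^-1 <= rate1 R n p su.
Proof.
move=> D1 suD; have D0 : 0 < D by lra.
apply: powR_ge_ratio => //; first by lra.
rewrite ler_pdivlMr// mulrC ler_pdivrMr// mulrC.
apply: le_trans suD _; rewrite ler_wpM2l ?(ltW D0)// ler_weXn2l//.
Qed.

Lemma rate1_ge : (n * p)%:R ^- 2 <= rate1 R n p su.
Proof.
have N1 : 1 <= (n * p)%:R :> R by rewrite ler1n; nia.
have N0 : 0 < (n * p)%:R :> R by lra.
apply: (@le_trans _ _ (n * p)%:R^-1).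
  by rewrite lef_pV2 ?posrE ?exprn_gt0// ler_eXnr.
apply: rate1_ge_ratio => //.
apply: (@le_trans _ _ (n * p)%:R); first by rewrite ler_nat; nia.
by apply: ler_peMr; [exact: ltW|exact: exprn_ege1].
Qed.

Lemma rate2_ge_ratio (D q gamma : R) : 1 <= D -> 0 < gamma -> 
  su%:R <= D * (n%:R `^ (2 / q) / gamma `^ (2 / q) * L ^+ 3) ->
  D^-1 <= rate2 n p su q gamma.
Proof.
move=> D1 g0 suD; have D0 : 0 < D by lra.
apply: powR_ge_ratio => //; first by lra.
have gq : 0 < gamma `^ (2 / q) by exact: powR_gt0.
rewrite ler_pdivlMr ?mulr_gt0//.
apply: (@le_trans _ _ (D^-1 * (gamma `^ (2 / q) *
    (D * (n%:R `^ (2 / q) / gamma `^ (2 / q) * L ^+ 3))))).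
  by rewrite ler_pM2l ?invr_gt0// ler_pM2l.
rewrite -/L le_eqVlt; apply/orP; left; apply/eqP.
by field; rewrite !gt_eqF.
Qed.

End rates.

(** For t = m / n the denominator n t (1 - t) is m (n - m) / n, and the term with
    [zeta] under the root is nonnegative. *)
Lemma signal_threshold_le (R : realType) (n p m : nat) (alpha zeta c dlt : R) :
  (4 <= n)%N -> (3 <= p)%N -> (0 < m < n)%N ->
  0 <= c -> 0 < zeta < 1 / 2 ->
  c * signal_threshold n p m alpha zeta <= dlt ->
  c * Num.sqrt (ln ((n * p)%:R / alpha)) <= Num.sqrt (m%:R * (n - m)%N%:R / n%:R) * dlt.
Proof.
move=> n4 p3 /andP[m0 mn] c0 /andP[z0 z1] cd.
set a := m%:R * (n - m)%N%:R / n%:R.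
have n0R : 0 < n%:R :> R by rewrite ltr0n; nia.
have a0 : 0 < a by rewrite /a divr_gt0// mulr_gt0// ltr0n// subn_gt0.
have aE : n%:R * (m%:R / n%:R) * (1 - m%:R / n%:R) = a.
  by rewrite /a natrB ?(ltnW mn)//; field; rewrite gt_eqF.
apply: (@le_trans _ _ (Num.sqrt a * (c * signal_threshold n p m alpha zeta))); last first.
  by rewrite ler_wpM2l ?sqrtr_ge0.
rewrite mulrCA ler_wpM2l// /signal_threshold aE -sqrtrM ?(ltW a0)//.
apply: ler_wsqrtr; rewrite mulrCA divff ?gt_eqF// mulr1 lerDr mulr_ge0//; last exact: le_trans (log_np_ge1 R n4 p3).
by rewrite ln_ge0// invf_ge1//; lra.
Qed.

(** * The two noise conditions *)

Section test.
Context d (Omega : measurableType d) (R : realType) (P : probability Omega R).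
Context (n p su m : nat) (mu delta : 'rV[R]_p) (Sigma : 'M[R]_p).
Variables (xi : 'I_n -> {RV P >-> p.-tuple R}) (e : 'I_n -> {RV P >-> R}).
Variables (alpha zeta bup : R).

Lemma condB_second_moment i j : condB P bup xi ->
  (\int[P]_w (tnth (xi i w) j ^+ 2)%:E <= (1 + bup ^+ 2)%:E)%E.
Proof.
move=> xib; have m2 : measurable_fun setT (fun w => tnth (xi i w) j).
  by apply: (measurableT_comp (measurable_tnth j)); exact: measurable_funPT.
apply: (@le_trans _ _ (\int[P]_w (1 + `|tnth (xi i w) j| ^+ 4)%:E)%E).
  apply: ge0_le_integral => //.
  - by move=> w _; rewrite lee_fin sqr_ge0.
  - by apply/measurable_EFinP; exact: measurable_funX.
  - apply/measurable_EFinP; apply: measurable_funD => //.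
    by apply: measurable_funX; exact: measurableT_comp.
  - move=> w _; rewrite lee_fin -[X in X <= _]real_normK ?num_real//.
    set a := `|_|; have -> : a ^+ 4 = (a ^+ 2) ^+ 2 by rewrite -exprM.
    by have := sqr_ge0 (a ^+ 2 - 1 / 2); lra.
under eq_integral do rewrite EFinD.
rewrite ge0_integralD//=; last first.
  apply/measurable_EFinP; apply: measurable_funX; exact: measurableT_comp.
rewrite integral_probability_cst EFinD leeD2l//.
by have := xib i j 2%N isT; rewrite unlock.
Qed.

Let X := mean_shift mu delta m xi.
Variable k : R.-pker (g_sigma_algebraType (g_sigma_preimage X)) ~> R.
Let Tstar w := boot_stat su (fun i => e i w) (fun i => vec (X i w)).

Hypotheses (bup0 : 0 < bup) (n4 : (4 <= n)%N) (p3 : (3 <= p)%N) (su0 : (1 <= su)%N)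
  (su2 : (2 * su <= n)%N) (sum : (su <= m <= n - su)%N) (d1 : `|delta| <= 1)
  (noise : noise_model Sigma xi) (boot : bootstrap_multipliers X e)
  (kP : regular_conditional_law P Tstar k) (xiB : condB P bup xi)
  (alpha01 : 0 < alpha < 1) (zeta01 : 0 < zeta < 1 / 2).
Hypothesis signal : (4 * Num.sqrt (2 + bup ^+ 2) + 6 + 2 * bup ^+ 2) *
  signal_threshold n p m alpha zeta <= `|delta|.

Let L : R := log_np R n p.
Let L1 : 1 <= L. Proof. exact: log_np_ge1. Qed.

Let sun : (su <= n)%N. Proof. exact: leq_trans (@leq_pmull su 2 isT) su2. Qed.

Let N0 : 0 < (n * p)%:R :> R.
Proof. by rewrite ltr0n muln_gt0 (leq_trans _ n4) ?(leq_trans _ p3). Qed.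

Let r_ge : (n * p)%:R ^- 2 <= rate1 R n p su. Proof. exact: rate1_ge. Qed.
Let zeta0 : 0 <= zeta. Proof. by case/andP: zeta01 => /ltW. Qed.

(** The second-moment bound of [condB_second_moment] is v = 1 + bup ^+ 2; the
    constant of the signal condition is that of [bootstrap_test_power] for it. *)
Lemma truncated_test_power (M eta : R) : 0 < M ->
  6 * M ^+ 2 * log_np R n p <= su%:R ->
  (P [set w | exists i j, (M < `|tnth (xi i w) j|)%R] <= eta%:E)%E ->
  ((1 - eta - 4 * (n * p)%:R ^- 2)%:E <= P [set w : Omega |
     (quantile (k w) (1 - alpha) < test_stat su (fun i => vec (X i w)))%R])%E.
Proof.
move=> M0 suM PM; case: noise => -[indep_xi _] xi_int xi_mean _.
have b2 : 0 <= bup ^+ 2 by exact: sqr_ge0.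
apply: (bootstrap_test_power (v := 1 + bup ^+ 2) (M := M) su0 sum d1 _ M0 n4 p3
  indep_xi _ _ _ suM boot kP alpha01 PM).
- by rewrite addr_ge0.
- by move=> i j; apply/Lfun1_integrable; exact: xi_int.
- by move=> i j; have := xi_mean i j; rewrite unlock.
- by move=> i j; exact: condB_second_moment.
have mn : (0 < m < n)%N by move: sum su0; clear; lia.
have -> : 1 + (1 + bup ^+ 2) = 2 + bup ^+ 2 by ring.
have -> : 4 * Num.sqrt (2 + bup ^+ 2) + 4 + 2 * (1 + bup ^+ 2) =
  4 * Num.sqrt (2 + bup ^+ 2) + 6 + 2 * bup ^+ 2 by ring.
apply: (signal_threshold_le n4 p3 mn _ zeta01 signal).
by rewrite !addr_ge0// mulr_ge0// sqrtr_ge0.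
Qed.

(** Truncation at M = 6 bup L: each coordinate exceeds it with probability at most
    2 (np)^-3, and 6 M^2 L = 216 bup^2 L^3.  If this is larger than [su], then the
    rate is at least the inverse of the constant in front of it. *)
Lemma test_power_psi1 (gamma : R) : 0 <= gamma -> condC P bup xi ->
  ((1 - gamma - (7 + 216 * bup ^+ 2) * rate1 R n p su - 2 * zeta)%:E <=
   P [set w : Omega |
     (quantile (k w) (1 - alpha) < test_stat su (fun i => vec (X i w)))%R])%E.
Proof.
move=> g0 xiC; have b2 : 0 <= bup ^+ 2 by exact: sqr_ge0.
have z0 := zeta0; have Lg := L1.
set D := 7 + 216 * bup ^+ 2; have D7 : 7 <= D by rewrite /D; lra.
have [suM|suM] := leP (216 * bup ^+ 2 * L ^+ 3) su%:R; last first.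
  apply: (@le_trans _ _ 0%E) => //; rewrite lee_fin.
  have D1 : 1 <= D by lra.
  have D0 : 0 < D by lra.
  have L3 : 0 <= L ^+ 3 by rewrite exprn_ge0//; lra.
  have : D^-1 <= rate1 R n p su.
    apply: rate1_ge_ratio => //; apply: ltW; apply: lt_le_trans suM _.
    by rewrite ler_wpM2r// /D; lra.
  by rewrite -[leLHS]mulr1 ler_pdivrMl//; lra.
have M0 : 0 < 6 * bup * L by rewrite !mulr_gt0//; lra.
have e3 : expR (- (6 * bup * L / (2 * bup))) = (n * p)%:R ^- 3.
  have -> : 6 * bup * L / (2 * bup) = 3%:R * L.
    by field; rewrite gt_eqF.
  by rewrite expRN expRM_natl lnK.
have PM : (P [set w | exists i j, (6 * bup * L < `|tnth (xi i w) j|)%R] <=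
    (2 * (n * p)%:R ^- 2)%:E)%E.
  apply: le_trans (psi1_noise_exceeds bup0 (ltW M0) xiC) _.
  rewrite lee_fin e3; move: N0; move: ((n * p)%:R : R) => N N_gt0.
  by rewrite le_eqVlt; apply/orP; left; apply/eqP; field; rewrite gt_eqF.
apply: le_trans (truncated_test_power M0 _ PM); last first.
  by rewrite -/L; move: suM; rewrite !exprMn; lra.
rewrite lee_fin.
have : 7 * rate1 R n p su <= D * rate1 R n p su by rewrite ler_wpM2r// powR_ge0.
have N2 : 0 <= ((n * p)%:R : R) ^- 2 by rewrite invr_ge0 exprn_ge0// ltW.
by have := r_ge; lra.
Qed.

(** Truncation at M = bup (n / gamma)^(1/q), which the noise exceeds with
    probability at most gamma; here M^2 is bup^2 times the ratio W occurring in the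
    second rate. *)
Lemma test_power_max_moment (q gamma : R) : 0 < q -> 0 < gamma -> condD P bup q xi ->
  ((1 - gamma - (7 + 6 * bup ^+ 2) * (rate1 R n p su + rate2 n p su q gamma) -
    2 * zeta)%:E <=
   P [set w : Omega |
     (quantile (k w) (1 - alpha) < test_stat su (fun i => vec (X i w)))%R])%E.
Proof.
move=> q0 g0 xiD; have b2 : 0 <= bup ^+ 2 by exact: sqr_ge0.
have z0 := zeta0; have Lg := L1.
have n0 : (0 < n)%N by exact: leq_trans n4.
have n0R : 0 < n%:R :> R by rewrite ltr0n.
set D := 7 + 6 * bup ^+ 2; have D7 : 7 <= D by rewrite /D; lra.
have D0 : 0 < D by lra.
have r1 : 0 <= rate1 R n p su by exact: powR_ge0.
have r2 : 0 <= rate2 n p su q gamma by exact: powR_ge0.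
have Dr1 : 7 * rate1 R n p su <= D * rate1 R n p su by rewrite ler_wpM2r.
pose W := n%:R `^ (2 / q) / gamma `^ (2 / q).
have W0 : 0 <= W by rewrite divr_ge0 ?powR_ge0.
set M := bup * (n%:R / gamma) `^ q^-1.
have M2 : M ^+ 2 = bup ^+ 2 * W.
  rewrite exprMn -[X in _ * X]powR_mulrn ?powR_ge0// -powRrM; congr (_ * _).
  rewrite [q^-1 * _]mulrC powRM ?invr_ge0 ?(ltW g0) ?(ltW n0R)//.
  by rewrite -(powR_inv1 (ltW g0)) -powRrM mulN1r powRN.
have M0 : 0 < M by rewrite mulr_gt0// powR_gt0// divr_gt0.
have [suM|suM] := leP (6 * M ^+ 2 * L) su%:R; last first.
  apply: (@le_trans _ _ 0%E) => //; rewrite lee_fin.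
  have D1 : 1 <= D by lra.
  have L3 : L <= L ^+ 3 by rewrite ler_eXnr.
  have : D^-1 <= rate2 n p su q gamma.
    apply: rate2_ge_ratio => //; rewrite -/L -/W; apply: ltW; apply: lt_le_trans suM _.
    have -> : 6 * M ^+ 2 * L = 6 * bup ^+ 2 * (W * L) by rewrite M2; ring.
    apply: (@le_trans _ _ (D * (W * L))).
      have WL0 : 0 <= W * L by rewrite mulr_ge0//; exact: le_trans L1.
      by apply: ler_wpM2r => //; rewrite /D lerDr; lra.
    by apply: ler_wpM2l; [exact: ltW|exact: ler_wpM2l].
  rewrite -[leLHS]mulr1 ler_pdivrMl// => h.
  have : 0 <= D * rate1 R n p su by rewrite mulr_ge0// ltW.
  by lra.
apply: le_trans (truncated_test_power M0 suM
  (max_moment_noise_exceeds n0 bup0 q0 g0 xiD)).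
rewrite lee_fin.
have : 0 <= D * rate2 n p su q gamma by rewrite mulr_ge0// ltW.
have N2 : 0 <= ((n * p)%:R : R) ^- 2 by rewrite invr_ge0 exprn_ge0// ltW.
by have := r_ge; lra.
Qed.

End test.

Theorem theorem3p3 (R : realType) (blow bup K : R)
    (blow_gt0 : 0 < blow) (bup_gt0 : 0 < bup) (K_gt0 : 0 < K) :
  (exists2 C1 : R, 0 < C1 & exists2 C2 : R, 0 < C2 &
    forall (d : measure_display) (Omega : measurableType d)
      (P : probability Omega R) (n p su m : nat)
      (mu delta : 'rV[R]_p) (Sigma : 'M[R]_p)
      (xi : 'I_n -> {RV P >-> p.-tuple R}) (e : 'I_n -> {RV P >-> R})
      (alpha zeta gamma : R),
    let X := mean_shift mu delta m xi in
    let T := fun w => test_stat su (fun i => vec (X i w)) in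
    let Tstar := fun w =>
      boot_stat su (fun i => e i w) (fun i => vec (X i w)) in
    forall k : R.-pker (g_sigma_algebraType (g_sigma_preimage X)) ~> R,
    (4 <= n)%N -> (3 <= p)%N -> (1 <= su)%N -> (2 * su <= n)%N ->
    (su <= m <= n - su)%N -> delta != 0 -> `|delta| <= 1 ->
    noise_model Sigma xi -> bootstrap_multipliers X e ->
    regular_conditional_law P Tstar k ->
    condA P blow xi -> condB P bup xi ->
    0 < alpha < 1 -> 0 < zeta < 1 / 2 -> 0 < gamma < expR (- 1) ->
    ln gamma^-1 <= K * log_np R n p ->
    condC P bup xi ->
    C1 * signal_threshold n p m alpha zeta <= `|delta| ->
    ((1 - gamma - C2 * rate1 R n p su - 2 * zeta)%:E
      <= P [set w | (quantile (k w) (1 - alpha) < T w)%R])%E)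
  /\
  (forall q : R, 0 < q ->
   exists2 C1 : R, 0 < C1 & exists2 C2 : R, 0 < C2 &
    forall (d : measure_display) (Omega : measurableType d)
      (P : probability Omega R) (n p su m : nat)
      (mu delta : 'rV[R]_p) (Sigma : 'M[R]_p)
      (xi : 'I_n -> {RV P >-> p.-tuple R}) (e : 'I_n -> {RV P >-> R})
      (alpha zeta gamma : R),
    let X := mean_shift mu delta m xi in
    let T := fun w => test_stat su (fun i => vec (X i w)) in
    let Tstar := fun w =>
      boot_stat su (fun i => e i w) (fun i => vec (X i w)) in
    forall k : R.-pker (g_sigma_algebraType (g_sigma_preimage X)) ~> R,
    (4 <= n)%N -> (3 <= p)%N -> (1 <= su)%N -> (2 * su <= n)%N ->
    (su <= m <= n - su)%N -> delta != 0 -> `|delta| <= 1 ->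
    noise_model Sigma xi -> bootstrap_multipliers X e ->
    regular_conditional_law P Tstar k ->
    condA P blow xi -> condB P bup xi ->
    0 < alpha < 1 -> 0 < zeta < 1 / 2 -> 0 < gamma < expR (- 1) ->
    ln gamma^-1 <= K * log_np R n p ->
    condD P bup q xi ->
    C1 * signal_threshold n p m alpha zeta <= `|delta| ->
    ((1 - gamma - C2 * (rate1 R n p su + rate2 n p su q gamma) - 2 * zeta)%:E
      <= P [set w | (quantile (k w) (1 - alpha) < T w)%R])%E).
Proof.
have b2 : 0 <= bup ^+ 2 by exact: sqr_ge0.
have C1_gt0 : 0 < 4 * Num.sqrt (2 + bup ^+ 2) + 6 + 2 * bup ^+ 2.
  by have := sqrtr_ge0 (2 + bup ^+ 2); lra.
split => [|q q0]; exists (4 * Num.sqrt (2 + bup ^+ 2) + 6 + 2 * bup ^+ 2) => //.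
  exists (7 + 216 * bup ^+ 2); first by lra.
  move=> d Omega P n p su m mu delta Sigma xi e alpha zeta gamma X T Tstar k.
  move=> n4 p3 su0 su2 sum _ d1 noise boot kP _ xiB alpha01 zeta01 gamma01 _ xiC signal.
  have [/ltW g0 _] := andP gamma01.
  exact: (test_power_psi1 bup_gt0 n4 p3 su0 su2 sum d1 noise boot kP xiB alpha01
    zeta01 signal g0 xiC).
exists (7 + 6 * bup ^+ 2); first by lra.
move=> d Omega P n p su m mu delta Sigma xi e alpha zeta gamma X T Tstar k.
move=> n4 p3 su0 su2 sum _ d1 noise boot kP _ xiB alpha01 zeta01 gamma01 _ xiD signal.
have [g0 _] := andP gamma01.
exact: (test_power_max_moment bup_gt0 n4 p3 su0 su2 sum d1 noise boot kP xiB alpha01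
  zeta01 signal q0 g0 xiD).
Qed.
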